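(* Let $T$ be the surface of an isosceles tetrahedron in $\mathbb{R}^3$ (a triangular pyramid all of whose faces are pairwise congruent), endowed with its intrinsic metric. Then the Steiner ratio of $T$ is equal to the Steiner ratio of the Euclidean plane: $\operatorname{sr}(T)=\operatorname{sr}(\mathbb{R}^2)$.
   Context: Steiner ratio. Let $(X,\rho)$ be a metric space. For a finite subset $M\subset X$, $\operatorname{mst}_X(M)$ is the length of a minimal spanning tree: the minimum, over all trees with vertex set $M$, of the sum of $\rho(x,y)$ over the edges $xy$ of the tree. Put $\operatorname{smt}_X(M)=\inf\{\operatorname{mst}_X(N): M\subset N\subset X,\ N \text{ finite}\}$. For finite $M$ with at least two elements put $\operatorname{sr}_X(M)=\operatorname{smt}_X(M)/\operatorname{mst}_X(M)$. The Steiner ratio of $X$ is $\operatorname{sr}(X)=\inf_M \operatorname{sr}_X(M)$ over all finite $M\subset X$ with at least two elements. The intrinsic metric on the surface $T$ (the union of the four faces) assigns to two points the infimum of the lengths of curves lying in $T$ and joining them. $\mathbb{R}^2$ carries the Euclidean metric. *)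

(* Defs.v *)
From HB Require Import structures.
From mathcomp Require Import all_boot all_order all_algebra finmap.
From mathcomp Require Import all_classical all_reals all_analysis.

Set Implicit Arguments.
Unset Strict Implicit.
Unset Printing Implicit Defensive.

Import Order.TTheory GRing.Theory Num.Theory.
Import numFieldNormedType.Exports.

Local Open Scope classical_set_scope.
Local Open Scope ring_scope.

Section SteinerRatio.

(* A simple graph on V is given by its adjacency relation. *)
Definition is_tree (V : finType) (e : rel V) : Prop :=
  [/\ symmetric e, irreflexive e,
      forall x y : V, connect e x y
    & forall c : seq V, ucycle e c -> (size c <= 2)%N].

(* The metric space is the subset X of U with distance rho; only the values of
   rho on X matter. *)
Context {R : realType} {U : choiceType}.
Implicit Types (X : set U) (rho : U -> U -> R) (M N : {fset U}).

(* Each edge is counted once in each direction, hence the factor 1/2. *)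
Definition graph_length rho M (e : rel M) : R :=
  2^-1 * \sum_(x : M) \sum_(y : M | e x y) rho (val x) (val y).

(* Infimum of a finite set, nonempty when M is nonempty: a minimum. *)
Definition mst rho M : R :=
  inf [set graph_length rho e | e in [set e : rel M | is_tree e]].

Definition smt X rho M : R :=
  inf [set mst rho N | N in [set N | (M `<=` N)%fset /\ [set` N] `<=` X]].

Definition steiner_ratio X rho : R :=
  inf [set smt X rho M / mst rho M |
        M in [set M | (2 <= #|` M|)%N /\ [set` M] `<=` X]].

End SteinerRatio.

Section Euclidean.
Context {R : realType} {n : nat}.
Implicit Types (x y : 'rV[R]_n) (A B T : set 'rV[R]_n) (g : R -> 'rV[R]_n).

(* The norm of the library on 'rV[R]_n is the sup norm, so the Euclidean
   distance is written out; the induced topologies coincide. *)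
Definition euclid_dist x y : R := Num.sqrt (\sum_i (x 0 i - y 0 i) ^+ 2).

Definition congruent A B : Prop :=
  exists f : 'rV[R]_n -> 'rV[R]_n,
    (forall x y, euclid_dist (f x) (f y) = euclid_dist x y) /\ f @` A = B.

Definition curve_in T x y g : Prop :=
  [/\ {within `[0, 1], continuous g}, g 0 = x, g 1 = y
    & forall t, t \in `[0, 1] -> T (g t)].

Definition inscribed_length g (s : seq R) : R :=
  let p := g \o nth 1 (0 :: s) in
  \sum_(0 <= i < size s) euclid_dist (p i) (p i.+1).

Definition curve_length g : \bar R :=
  ereal_sup [set (inscribed_length g s)%:E | s in itv_partition 0 1].

(* [fine] turns an infinite value into 0; no such value occurs when any two points
   of T are joined inside T by a curve of finite length, as on the surface of a
   tetrahedron. *)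
Definition intrinsic_dist T x y : R :=
  fine (ereal_inf [set curve_length g | g in curve_in T x y]).

End Euclidean.

Section Tetrahedron.
Context {R : realType}.
Implicit Types v : 'I_4 -> 'rV[R]_3.

(* The four vertices are affinely independent. *)
Definition is_tetrahedron v : Prop :=
  row_free (\matrix_(i < 3) (v (lift ord0 i) - v ord0)).

(* The face opposite to the vertex v i, a full triangle. *)
Definition face v (i : 'I_4) : set 'rV[R]_3 :=
  [set x | exists w : 'I_4 -> R,
    [/\ forall j, 0 <= w j, \sum_(j | j != i) w j = 1
      & x = \sum_(j | j != i) w j *: v j]].

Definition isosceles v : Prop := forall i j, congruent (face v i) (face v j).

Definition tetrahedron_surface v : set 'rV[R]_3 := \bigcup_i face v i.

End Tetrahedron.

(* Main.v *)
Require Import Defs.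
From HB Require Import structures.
From mathcomp Require Import all_boot all_order all_algebra finmap.
From mathcomp Require Import all_classical all_reals all_analysis.
From mathcomp Require Import lra.

Set Implicit Arguments.
Unset Strict Implicit.
Unset Printing Implicit Defensive.

Import Order.TTheory GRing.Theory Num.Theory.
Import numFieldNormedType.Exports.

Local Open Scope classical_set_scope.
Local Open Scope ring_scope.

(* In the box circumscribed about an isosceles tetrahedron the axes A, B, C are
   orthogonal and the vertices are the sign vectors with product 1. With [wave] the
   triangle wave of period 2, the map (s, t) |-> wave t A + wave s B + wave (s + t) C
   folds the plane onto the surface T: for a suitable Euclidean structure on the plane
   it is 1-Lipschitz, and isometric on each triangle cut out by the lines where s, t or
   s + t is an integer. A curve in T starting at the image of x lifts from x without
   becoming longer, because nearby points of T share a face; hence the intrinsic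
   distance is recovered from the plane by lifting.

   Lifting a spanning tree edge by edge and projecting it back shows that T has at
   least the Steiner ratio of the plane. Conversely a small similar copy of any finite
   planar set fits in one triangle, so that its spanning trees keep their lengths up to
   the scale, while projecting planar Steiner trees never lengthens them. *)

(** * Trees built by attaching one leaf after another *)

Section Growth.
Context {R : realType}.

(* A growth lists the vertices of a tree, latest first, each later vertex being
   attached to an earlier one; the real number is the length of the tree. *)
Inductive growth (U : eqType) (rho : U -> U -> R) : seq U -> R -> Prop :=
| growth_root x : growth rho [:: x] 0
| growth_leaf x y S l : growth rho S l -> y \in S -> x \notin S ->
    growth rho (x :: S) (l + rho y x).

Lemma growth_uniq (U : eqType) (rho : U -> U -> R) S l :
  growth rho S l -> uniq S.
Proof. by elim=> [x|x y S' l' _ /= -> _ ->]. Qed.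

Lemma growth_scale (U : eqType) (rho : U -> U -> R) k S l :
  growth rho S l -> growth (fun x y => k * rho x y) S (k * l).
Proof.
elim=> [x|x y S' l' _ IH yS xS]; first by rewrite mulr0; exact: growth_root.
by rewrite mulrDr; exact: growth_leaf.
Qed.

Lemma growth_exists (U : eqType) (rho : U -> U -> R) S :
  uniq S -> S != [::] -> exists l, growth rho S l.
Proof.
elim: S => // x [_ _ _|y S IH /andP[xS uS] _]; first by exists 0; exact: growth_root.
have [l gl] := IH uS isT.
by exists (l + rho y x); apply: growth_leaf => //; exact: mem_head.
Qed.

(** The images are attached in the same order. A vertex whose image is already present is skipped
    with its edge, which only shortens the tree because [d] is nonnegative on [S]. *)
Lemma growth_image (U W : eqType) (rho : U -> U -> R) (d : W -> W -> R)
    (f : W -> U) S l :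
  growth d S l ->
  {in S &, forall x y, rho (f x) (f y) <= d x y} ->
  {in S &, forall x y, 0 <= d x y} ->
  exists S' l', [/\ growth rho S' l', S' =i map f S & l' <= l].
Proof.
elim=> [x _ _|x y S0 l0 g0 IH yS xS le_rho d_ge0].
  by exists [:: f x], 0; split=> //; exact: growth_root.
have [| |S' [l' [g' eS' le_l]]] := IH.
- by move=> a b aS bS; apply: le_rho; rewrite inE ?aS ?bS orbT.
- by move=> a b aS bS; apply: d_ge0; rewrite inE ?aS ?bS orbT.
have yS1 : y \in x :: S0 by rewrite inE yS orbT.
have [fxS|fxS] := boolP (f x \in S').
  exists S', l'; split=> //; last by rewrite (le_trans le_l)// lerDl d_ge0 ?mem_head.
  move=> z; rewrite eS' /= inE.
  by case: eqP => // ->; rewrite -eS' fxS.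
exists (f x :: S'), (l' + rho (f y) (f x)); split.
- by apply: growth_leaf => //; rewrite eS' map_f.
- by move=> z; rewrite /= !inE eS'.
- by rewrite lerD// le_rho ?mem_head.
Qed.

(** Each new vertex is lifted starting from the lift of the vertex it is attached to, so every one
    of the [(size S).-1] edges costs the slack [e] once. *)
Lemma growth_lift (U W : eqType) (rho : U -> U -> R) (d : W -> W -> R)
    (f : W -> U) (e : R) S l :
  growth rho S l ->
  {in S, forall q, exists y, f y = q} ->
  (forall x, {in S, forall q, exists2 y, f y = q & d x y <= rho (f x) q + e}) ->
  exists S' l',
    [/\ growth d S' l', map f S' = S & l' <= l + (size S).-1%:R * e].
Proof.
elim=> [x /(_ x (mem_head _ _))[y <-] _|x y S0 l0 g0 IH yS xS surj lift].
  by exists [:: y], 0; rewrite /= mul0r addr0; split=> //; exact: growth_root.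
have [| |S' [l' [g' eS' le_l]]] := IH.
- by move=> a aS; apply: surj; rewrite inE aS orbT.
- by move=> a b bS; apply: lift; rewrite inE bS orbT.
have [b bS' eb] : exists2 b, b \in S' & y = f b by apply/mapP; rewrite eS'.
have [a ea le_d] := lift b x (mem_head _ _).
exists (a :: S'), (l' + d b a); split.
- apply: growth_leaf => //; apply: contra xS.
  by move=> /(map_f f); rewrite eS' ea.
- by rewrite /= eS' ea.
- rewrite eb; have -> : (size (x :: S0)).-1 = (size S0).-1.+1.
    by case: (S0) yS.
  rewrite -natr1 mulrDl mul1r.
  by move: le_l le_d; set u := _ * e; lra.
Qed.

(** The tree is at least as long as the path inside it between two vertices, to which the triangle
    inequality for [delta] applies. This keeps [mst] away from 0. *)
Lemma growth_ge (U : eqType) (rho delta : U -> U -> R) S l :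
  growth rho S l ->
  {in S &, forall x y, delta x y <= rho x y} ->
  {in S &, forall x y, 0 <= delta x y} ->
  (forall x, delta x x = 0) -> (forall x y, delta x y = delta y x) ->
  (forall x y z, delta x z <= delta x y + delta y z) ->
  {in S &, forall x y, delta x y <= l}.
Proof.
move=> + + + d0 dC dD.
elim=> [x _ _ a b|x y S0 l0 g0 IH yS xS le_rho d_ge0].
  by rewrite !inE => /eqP-> /eqP->; rewrite d0.
have sub a : a \in S0 -> a \in x :: S0 by rewrite inE orbC => ->.
have {}IH : {in S0 &, forall a b, delta a b <= l0}.
  apply: IH => a b aS bS; [apply: le_rho | apply: d_ge0]; exact: sub.
have rho_ge : delta y x <= rho y x by rewrite le_rho ?mem_head ?sub.
have rho_ge0 : 0 <= delta y x by rewrite d_ge0 ?mem_head ?sub.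
have new a : a \in S0 -> delta a x <= l0 + rho y x.
  by move=> aS; rewrite (le_trans (dD a y x))// lerD// IH.
have l0_ge0 : 0 <= l0 by rewrite -(d0 y) IH.
move=> a b; rewrite !inE => /predU1P[->|aS] /predU1P[->|bS].
- by rewrite d0; lra.
- by rewrite dC new.
- exact: new.
- by have := IH a b aS bS; lra.
Qed.

Lemma sum_at_pair (V : finType) (w : V -> V -> R) x y :
  \sum_a \sum_b (if (a == x) && (b == y) then w a b else 0) = w x y.
Proof.
rewrite (bigD1 x)//= (bigD1 y)//= !eqxx big1 => [|b /negPf->//].
by rewrite big1 ?addr0// => a /negPf->; rewrite big1.
Qed.

(** A new leaf has a single neighbour, hence lies on no cycle with more than two vertices. *)
Lemma growth_to_tree (V : finType) (w : V -> V -> R) S l :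
  (forall x y, w x y = w y x) -> growth w S l ->
  exists e : rel V,
    [/\ symmetric e, irreflexive e, {in S &, forall x y, connect e x y},
        forall c, ucycle e c -> (size c <= 2)%N
      & (forall x y, e x y -> x \in S) /\
        2^-1 * (\sum_x \sum_(y | e x y) w x y) = l].
Proof.
move=> wC; elim=> [x|x y S0 l0 g0 [e [eC e0 econ ecyc [eS el]]] yS xS].
  exists (fun _ _ => false); split=> //.
  - by move=> a b; rewrite !inE => /eqP-> /eqP->.
  - by case=> [|a [|b c]].
  - split=> //; rewrite big1 ?mulr0// => a _.
    by rewrite big_pred0.
pose e' a b := [|| e a b, (a == x) && (b == y) | (a == y) && (b == x)].
have ex a : e x a = false by apply/negP => /eS; rewrite (negPf xS).
have xy : (x == y) = false by apply/eqP => xy; rewrite xy yS in xS.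
have e'C : symmetric e'.
  by move=> a b; rewrite /e' eC; congr (_ || _); rewrite orbC andbC [X in _ || X]andbC.
have sub : subrel (connect e) (connect e').
  by apply: connect_sub => a b ab; apply: connect1; rewrite /e' ab.
have c'C : connect_sym e' := sym_connect_sym e'C.
have xcon a : a \in S0 -> connect e' a x.
  move=> aS; apply: (connect_trans (sub _ _ (econ _ _ aS yS))).
  by apply: connect1; rewrite /e' !eqxx !orbT.
have x_nbr a : e' x a -> a = y.
  by rewrite /e' ex xy eqxx/= orbF => /eqP.
exists e'; split=> //.
- move=> a; rewrite /e' e0 /=; apply/negP.
  by case/orP=> /andP[/eqP->]; rewrite ?xy// eq_sym xy.
- move=> a b; rewrite !inE => /predU1P[->|aS] /predU1P[->|bS] //.
  + by rewrite c'C xcon.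
  + exact: xcon.
  + exact/sub/econ.
- move=> c /andP[cc uc]; rewrite leqNgt; apply/negP => c_gt2.
  have [xc|xc] := boolP (x \in c); last first.
    have : (size c <= 2)%N; last by rewrite leqNgt c_gt2.
    apply: ecyc; rewrite /ucycle uc andbT.
    apply: (@sub_in_cycle _ (mem c) e' e) cc; last exact/allP.
    move=> a b ac bc /or3P[//|/andP[/eqP ax _]|/andP[_ /eqP bx]].
      by rewrite -ax ac in xc.
    by rewrite -bx bc in xc.
  (* Once the cycle starts at [x], its second and its last vertex are neighbours of [x], hence both
     equal to [y], against uniqueness. *)
  have [i c' rc] := rot_to xc.
  have cc' : cycle e' (x :: c') by rewrite -rc rot_cycle.
  have uc' : uniq (x :: c') by rewrite -rc rot_uniq.
  have sc' : (2 < size (x :: c'))%N by rewrite -rc size_rot.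
  case: c' cc' uc' sc' {rc} => //= a c'; case: (lastP c') => //= c'' b.
  rewrite !rcons_path last_rcons => /and3P[/x_nbr-> _ bx] /and3P[_ + _] _.
  by rewrite e'C in bx; rewrite (x_nbr _ bx) mem_rcons mem_head.
- split=> [a b /or3P[/eS|/andP[/eqP-> _]|/andP[/eqP-> _]]|].
  + by rewrite inE orbC => ->.
  + exact: mem_head.
  + by rewrite inE yS orbT.
  rewrite -el.
  rewrite (_ : \sum_a \sum_(b | e' a b) w a b =
     \sum_a \sum_(b | e a b) w a b + w x y + w y x); last first.
    rewrite -(sum_at_pair w x y) -(sum_at_pair w y x) -!big_split/=.
    apply: eq_bigr => a _; rewrite big_mkcond [\sum_(b | e _ _) _]big_mkcond/=.
    rewrite -!big_split/=; apply: eq_bigr => b _; rewrite /e'.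
    have [->|ax] := eqVneq a x; first by rewrite ex xy/=; case: eqP => _; rewrite /= ?add0r ?addr0.
    have [->|bx] := eqVneq b x; last by rewrite /= !andbF !orbF !addr0.
    by rewrite eC ex andbT/= !add0r.
  by rewrite (wC x y); lra.
Qed.

(** As long as a vertex is missing, connectedness yields an edge leaving the set reached so far. *)
Lemma connected_to_growth (V : finType) (w : V -> V -> R) (e : rel V) (r : V) :
  symmetric e -> (forall x y, connect e x y) ->
  (forall x y, w x y = w y x) -> (forall x y, 0 <= w x y) ->
  exists S l, [/\ growth w S l, forall x, x \in S
    & l <= 2^-1 * (\sum_x \sum_(y | e x y) w x y)].
Proof.
move=> eC econ wC w0.
(* Edges inside [S], counted in both directions: half of [W S] bounds the growth at each stage. *)
pose W (S : seq V) :=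
  \sum_a \sum_b (if [&& a \in S, b \in S & e a b] then w a b else 0).
suff H k : (k < #|V|)%N ->
    exists S l, [/\ growth w S l, size S = k.+1 & l <= 2^-1 * W S].
  have V0 : (0 < #|V|)%N by apply/card_gt0P; exists r.
  have [|S [l [g sS le_l]]] := H #|V|.-1; first by rewrite ltn_predL.
  rewrite prednK// in sS; exists S, l; split=> //.
    have cS : #|S| = #|V| by rewrite (card_uniqP (growth_uniq g)).
    by move=> x; rewrite (subset_cardP cS (subset_predT _)).
  rewrite (le_trans le_l)// ler_pM2l ?invr_gt0// ler_sum// => a _.
  rewrite [leRHS]big_mkcond/=; apply: ler_sum => b _.
  by case: ifP => [/and3P[_ _ ->]//|_]; case: ifP.
elim: k => [_|k IH kV].
  exists [:: r], 0; split=> //; first exact: growth_root.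
  by rewrite mulr_ge0 ?invr_ge0// sumr_ge0// => a _; rewrite sumr_ge0// => b _; case: ifP.
have [S [l [g sS le_l]]] := IH (ltnW kV).
have [y yS [x xS yx]] : exists2 y, y \in S & exists2 x, x \notin S & e y x.
  apply: contrapT => H.
  have clS : fingraph.closed e (mem S).
    have imp a b : e a b -> a \in S -> b \in S.
      move=> ab aS; apply/negPn/negP => bS; apply: H.
      by exists a => //; exists b.
    by move=> a b ab; apply/idP/idP; apply: imp => //; rewrite eC.
  have [y yS] : exists y, y \in S by case: (S) sS => // y *; exists y; exact: mem_head.
  have all_in x : x \in S by rewrite -(closed_connect clS (econ y x)).
  have := card_uniqP (growth_uniq g); rewrite sS => cS.
  suff : (#|V| <= k.+1)%N by rewrite leqNgt kV.
  by rewrite -cS; apply/subset_leq_card/fintype.subsetP => z _; exact: all_in.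
exists (x :: S), (l + w y x); split; [exact: growth_leaf | by rewrite /= sS |].
suff : W S + w x y + w y x <= W (x :: S) by rewrite (wC x y); lra.
rewrite /W -(sum_at_pair w x y) -(sum_at_pair w y x) -!big_split/=.
apply: ler_sum => a _; rewrite -!big_split/=; apply: ler_sum => b _.
have xy : (x == y) = false by apply/eqP => xy; rewrite xy yS in xS.
have [->|ax] := eqVneq a x.
  rewrite (negPf xS) xy/= add0r addr0 mem_head/=.
  have [->|_] := eqVneq b y; first by rewrite inE yS orbT eC yx.
  by case: ifP.
have [->|bx] := eqVneq b x.
  rewrite (negPf xS) andbT !andbF/= !add0r mem_head/=.
  have [->|_] := eqVneq a y; first by rewrite inE yS orbT yx.
  by case: ifP.
by rewrite !andbF/= !addr0 !inE (negPf ax) (negPf bx).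
Qed.

End Growth.

(** * Minimal spanning trees, Steiner trees and their ratio as infima *)

Section MinimalTrees.
Context {R : realType}.

Lemma inf_ge0 (A : set R) : (forall x, A x -> 0 <= x) -> 0 <= inf A.
Proof.
move=> A_ge0; have [->|/set0P A0] := eqVneq A set0; first by rewrite inf0.
exact: lb_le_inf.
Qed.

Section Spanning.
Context {U : choiceType} (rho : U -> U -> R).
Hypothesis rho_ge0 : forall x y, 0 <= rho x y.

Lemma graph_length_ge0 (M : {fset U}) (e : rel M) : 0 <= graph_length rho e.
Proof.
rewrite mulr_ge0 ?invr_ge0// sumr_ge0// => a _.
by rewrite sumr_ge0.
Qed.

Lemma mst_ge0 (M : {fset U}) : 0 <= mst rho M.
Proof. by apply: inf_ge0 => _ [e _ <-]; exact: graph_length_ge0. Qed.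

(** Lifting along [val] with slack 0 moves the growth into the finite type of the elements of
    [M]. *)
Lemma growth_spanning_tree (M : {fset U}) S l :
  {in M &, forall x y, rho x y = rho y x} -> growth rho S l -> S =i M ->
  exists2 e : rel M, is_tree e & graph_length rho e <= l.
Proof.
move=> rhoC g eS.
pose w (x y : M) := rho (val x) (val y).
have [||S' [l' [g' eS' le_l]]] :=
  @growth_lift _ _ _ rho w val 0 _ _ g.
- by move=> q; rewrite eS => qM; exists [` qM]%fset.
- move=> x q; rewrite eS => qM; exists [` qM]%fset => //.
  by rewrite addr0.
have [|e [eC e0 econ ecyc [_ el]]] := growth_to_tree _ g'.
  by move=> x y; apply: rhoC; exact: valP.
exists e; last by rewrite /graph_length el; rewrite mulr0 addr0 in le_l.
have S'T x : x \in S'.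
  have : val x \in map val S' by rewrite eS' eS; exact: valP.
  by rewrite mem_map//; exact: val_inj.
by split=> // x y; apply: econ.
Qed.

Lemma mst_le_growth (M : {fset U}) S l :
  {in M &, forall x y, rho x y = rho y x} -> growth rho S l -> S =i M ->
  mst rho M <= l.
Proof.
move=> rhoC g eS; have [e te le_l] := growth_spanning_tree rhoC g eS.
apply: le_trans le_l; apply: ge_inf; last by exists e.
by exists 0 => _ [e' _ <-]; exact: graph_length_ge0.
Qed.

(** Growths suffice for lower bounds, because every connected graph contains one that is not
    longer. *)
Lemma mst_ge (M : {fset U}) c x :
  {in M &, forall x y, rho x y = rho y x} -> x \in M ->
  (forall S l, growth rho S l -> S =i M -> c <= l) -> c <= mst rho M.
Proof.
move=> rhoC xM c_le; apply: lb_le_inf.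
  (* The infimum must be taken over a nonempty set: [inf] of the empty set is 0. *)
  have [|l g] := @growth_exists R _ rho M (fset_uniq M).
    by apply/eqP => M0; move: xM; rewrite -[_ \in M]/(x \in (M : seq U)) M0.
  have [e te _] := growth_spanning_tree rhoC g (fun _ => erefl).
  by exists (graph_length rho e), e.
move=> _ [e [eC e0 econ _] <-].
pose w (x y : M) := rho (val x) (val y).
have [||S [l [g ST le_l]]] := @connected_to_growth R _ w e [` xM]%fset eC econ.
- by move=> a b; apply: rhoC; exact: valP.
- by move=> a b; exact: rho_ge0.
have [||S' [l' [g' eS' le_l']]] := @growth_image R _ _ rho w val _ _ g.
- by move=> a b _ _; exact: lexx.
- by move=> a b _ _; exact: rho_ge0.
apply: le_trans le_l; apply: le_trans le_l'; apply: c_le g' _ => z.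
rewrite eS'; apply/mapP/idP => [[a _ ->]|zM]; first exact: valP.
by exists [` zM]%fset.
Qed.

(** Otherwise [mst rho M + e] would bound all growths from below. An almost minimal growth is enough
    for lifting, which costs an arbitrarily small error anyway. *)
Lemma mst_growth_lt (M : {fset U}) (e : R) x :
  {in M &, forall x y, rho x y = rho y x} -> x \in M -> 0 < e ->
  exists S l, [/\ growth rho S l, S =i M & l < mst rho M + e].
Proof.
move=> rhoC xM e0; apply: contrapT => H.
suff : mst rho M + e <= mst rho M by rewrite gerDl leNgt e0.
apply: (mst_ge rhoC xM) => S l g eS; rewrite leNgt; apply/negP => lt_l.
by apply: H; exists S, l.
Qed.

(** Keeps the denominators of the Steiner ratio away from 0, where division would return 0. *)
Lemma mst_gt0 (delta : U -> U -> R) (M : {fset U}) :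
  {in M &, forall x y, rho x y = rho y x} ->
  {in M &, forall x y, delta x y <= rho x y} ->
  (forall x, delta x x = 0) -> (forall x y, delta x y = delta y x) ->
  (forall x y z, delta x z <= delta x y + delta y z) ->
  (forall x y, x != y -> 0 < delta x y) ->
  (2 <= #|` M|)%N -> 0 < mst rho M.
Proof.
move=> rhoC le_rho d0 dC dD d_gt0 M2.
have [x [y [xM yM xy]]] : exists x y, [/\ x \in M, y \in M & x != y].
  move: M2 (fset_uniq M); rewrite -[#|` M|]/(size (M : seq U)).
  case E : (M : seq U) => [|x [|y s]]// _ /andP[xs _].
  exists x, y; rewrite -![_ \in M]/(_ \in (M : seq U)) E !inE !eqxx orbT; split=> //.
  by apply: contra xs => /eqP->; rewrite mem_head.
apply: lt_le_trans (d_gt0 _ _ xy) _; apply: (mst_ge rhoC xM) => S l g eS.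
apply: (growth_ge g) => //; rewrite ?eS// => a b; rewrite !eS => aM bM; first exact: le_rho.
have [->|ab] := eqVneq a b; first by rewrite d0.
by rewrite ltW ?d_gt0.
Qed.

Section Ratio.
Context (X : set U).
Implicit Types M N : {fset U}.

Lemma smt_ge0 M : 0 <= smt X rho M.
Proof. by apply: inf_ge0 => _ [N _ <-]; exact: mst_ge0. Qed.

Lemma smt_le M N : (M `<=` N)%fset -> [set` N] `<=` X -> smt X rho M <= mst rho N.
Proof.
move=> MN NX; apply: ge_inf; last by exists N.
by exists 0 => _ [N' _ <-]; exact: mst_ge0.
Qed.

Lemma smt_ge M c : [set` M] `<=` X ->
  (forall N, (M `<=` N)%fset -> [set` N] `<=` X -> c <= mst rho N) ->
  c <= smt X rho M.
Proof.
move=> MX c_le; apply: lb_le_inf; first by exists (mst rho M), M.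
by move=> _ [N [MN NX] <-]; exact: c_le.
Qed.

Lemma steiner_ratio_ge0 : 0 <= steiner_ratio X rho.
Proof. by apply: inf_ge0 => _ [M _ <-]; rewrite divr_ge0 ?smt_ge0 ?mst_ge0. Qed.

Lemma steiner_ratio_le M : (2 <= #|` M|)%N -> [set` M] `<=` X ->
  steiner_ratio X rho <= smt X rho M / mst rho M.
Proof.
move=> M2 MX; apply: ge_inf; last by exists M.
by exists 0 => _ [N _ <-]; rewrite divr_ge0 ?smt_ge0 ?mst_ge0.
Qed.

Lemma steiner_ratio_ge M c : (2 <= #|` M|)%N -> [set` M] `<=` X ->
  (forall N, (2 <= #|` N|)%N -> [set` N] `<=` X -> c <= smt X rho N / mst rho N) ->
  c <= steiner_ratio X rho.
Proof.
move=> M2 MX c_le; apply: lb_le_inf; first by exists (smt X rho M / mst rho M), M.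
by move=> _ [N [N2 NX] <-]; exact: c_le.
Qed.

End Ratio.
End Spanning.

End MinimalTrees.

(** * Comparison of Steiner ratios along a folding map *)

Section Folding.
Context {R : realType}.

(* The last hypothesis transplants a similar copy of any finite configuration of
   the plane to a region which the folding map carries isometrically. *)
Lemma steiner_ratio_folding (U W : choiceType) (X : set U)
    (rho delta : U -> U -> R) (d : W -> W -> R) (f : W -> U) (w1 w2 : W) :
  (forall x y, 0 <= rho x y) ->
  (forall x, delta x x = 0) -> (forall x y, delta x y = delta y x) ->
  (forall x y z, delta x z <= delta x y + delta y z) ->
  (forall x y, x != y -> 0 < delta x y) ->
  (forall x y, X x -> X y -> delta x y <= rho x y) ->
  (forall x, d x x = 0) -> (forall x y, d x y = d y x) ->
  (forall x y z, d x z <= d x y + d y z) ->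
  (forall x y, x != y -> 0 < d x y) ->
  w1 != w2 ->
  (forall x, X (f x)) -> (forall q, X q -> exists x, f x = q) ->
  (forall x y, rho (f x) (f y) <= d x y) ->
  (forall x q e, X q -> 0 < e ->
    exists2 y, f y = q & d x y <= rho (f x) q + e) ->
  (forall M : {fset W}, exists (k : R) (h : W -> W),
    [/\ 0 < k, forall x y, d (h x) (h y) = k * d x y
      & {in M &, forall x y, rho (f (h x)) (f (h y)) = k * d x y}]) ->
  steiner_ratio X rho = steiner_ratio [set: W] d.
Proof.
move=> rho_ge0 delta0 deltaC deltaD delta_gt0 delta_le d0 dC dD d_gt0 w12.
move=> fX surj f_le lift similar.
have d_ge0 x y : 0 <= d x y.
  by have [->|xy] := eqVneq x y; [rewrite d0 | rewrite ltW ?d_gt0].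
(* Symmetry on [X] comes from the folding: lift [q], lift [p] from there at cost at most
   [rho q p + e], then project the reversed pair. *)
have rho_le p q : X p -> X q -> rho p q <= rho q p.
  move=> Xp Xq; apply/ler_addgt0Pr => e e0.
  have [x fx] := surj _ Xq; have [y fy le_d] := lift x p e Xp e0.
  by rewrite -{1}fx -{1}fy (le_trans (f_le _ _))// dC (le_trans le_d)// fx.
have rhoC (M : {fset U}) : [set` M] `<=` X -> {in M &, forall p q, rho p q = rho q p}.
  by move=> MX p q pM qM; apply/eqP; rewrite eq_le !rho_le//; exact: MX.
have dCM (M : {fset W}) : {in M &, forall x y, d x y = d y x} by move=> *; exact: dC.
have d_mst_gt0 (M : {fset W}) : (2 <= #|` M|)%N -> 0 < mst d M.
  by apply: (mst_gt0 d_ge0 (dCM M)) d0 dC dD d_gt0.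
have rho_mst_gt0 (M : {fset U}) :
    [set` M] `<=` X -> (2 <= #|` M|)%N -> 0 < mst rho M.
  move=> MX; apply: (mst_gt0 rho_ge0 (rhoC M MX)) delta0 deltaC deltaD delta_gt0.
  by move=> p q pM qM; apply: delta_le; exact: MX.
have elt (V : choiceType) (M : {fset V}) : (2 <= #|` M|)%N -> exists x, x \in M.
  move=> M2; have /fset0Pn[x xM] : M != fset0 by rewrite -cardfs_gt0 ltnW.
  by exists x.
have M0_card : (2 <= #|` [fset w1; w2]%fset|)%N by rewrite cardfs2 w12.
have img (g : W -> U) (N : {fset W}) (k : R) x : x \in N -> 0 < k ->
    (forall y, X (g y)) -> (forall y z, rho (g y) (g z) <= k * d y z) ->
    mst rho [fset g y | y in N]%fset <= k * mst d N.
  move=> xN k0 gX g_le.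
  have gNX : [set` [fset g y | y in N]%fset] `<=` X.
    by move=> _ /imfsetP[y _ ->]; exact: gX.
  rewrite mulrC -ler_pdivrMr//.
  apply: (mst_ge d_ge0 (dCM N) xN) => S l gS eS; rewrite ler_pdivrMr// mulrC.
  have [||S' [l' [gS' eS' le_l]]] := growth_image (rho := rho) (f := g) (growth_scale k gS).
  - by move=> y z _ _; exact: g_le.
  - by move=> y z _ _; rewrite mulr_ge0// ltW.
  apply: le_trans le_l; apply: (mst_le_growth rho_ge0 (rhoC _ gNX) gS') => q.
  rewrite eS'; apply/mapP/imfsetP => -[y yS ->]; exists y => //; first by rewrite -eS.
  by rewrite eS.
have sim_inj k h (N : {fset W}) : 0 < k ->
    {in N &, forall x y, rho (f (h x)) (f (h y)) = k * d x y} ->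
    {in N &, injective (fun y => f (h y))}.
  move=> k0 hrho y z yN zN gyz; apply/eqP/negPn/negP => yz.
  have := hrho y z yN zN; rewrite gyz.
  rewrite (_ : rho _ _ = 0).
    by move=> /esym/eqP; rewrite gt_eqF// mulr_gt0// d_gt0.
  by apply/eqP; rewrite eq_le rho_ge0 andbT (le_trans (f_le _ _))// d0.
apply/eqP; rewrite eq_le; apply/andP; split.
(* The ratio of [X] is at most that of [W]: the copy [M] of [N] in [X] does at least as well as
   [N]. *)
- apply: (steiner_ratio_ge M0_card) => // N N2 _.
  have [x xN] := elt _ _ N2.
  have [k [h [k0 hd hrho]]] := similar N.
  pose g y := f (h y).
  have gX y : X (g y) by exact: fX.
  have g_le y z : rho (g y) (g z) <= k * d y z by rewrite -hd; exact: f_le.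
  pose M := [fset g y | y in N]%fset.
  have MX : [set` M] `<=` X by move=> _ /imfsetP[y _ ->].
  have g_inj : {in N &, injective g} := sim_inj k h N k0 hrho.
  have M2 : (2 <= #|` M|)%N by rewrite card_in_imfset.
  (* This left inverse pulls spanning trees of [M] back to [N], dividing their lengths by [k]. *)
  have [g' g'K] : exists g' : U -> W, forall y, y \in N -> g' (g y) = y.
    have [g' g'P] : {g' : U -> W & forall q, q \in M -> g' q \in N /\ g (g' q) = q}.
      pose Q (q : U) (y : W) := q \in M -> y \in N /\ g y = q.
      apply: (@choice _ _ Q) => q; have [|qM] := boolP (q \in M).
        by move=> /imfsetP[y yN ->]; exists y.
      by exists x => qM'; rewrite qM' in qM.
    exists g' => y yN; have [|g'N gg'] := g'P (g y); first by apply/imfsetP; exists y.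
    exact: g_inj.
  have mst_le : k * mst d N <= mst rho M.
    apply: (mst_ge rho_ge0 (rhoC M MX) (x := g x)); first by apply/imfsetP; exists x.
    move=> S l gS eS; rewrite mulrC -ler_pdivlMr//.
    have {}gS := growth_scale k^-1 gS.
    have [||S' [l' [gS' eS' le_l]]] := growth_image (rho := d) (f := g') gS.
    + move=> p q; rewrite !eS => /imfsetP[y yN ->] /imfsetP[z zN ->].
      by rewrite !g'K//= /g hrho// mulKf ?gt_eqF.
    + by move=> p q _ _; rewrite mulr_ge0 ?invr_ge0 ?(ltW k0).
    rewrite mulrC; apply: le_trans le_l; apply: (mst_le_growth d_ge0 (dCM _) gS') => y.
    rewrite eS'; apply/mapP/idP => [[p]|yN].
      by rewrite eS => /imfsetP[z zN ->] ->; rewrite g'K.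
    by exists (g y); [rewrite eS; apply/imfsetP; exists y | rewrite g'K].
  (* Each finite set containing [N] projects to one containing [M], with trees that are not longer
     up to the scale. *)
  have smt_le' : smt X rho M <= k * smt [set: W] d N.
    rewrite mulrC -ler_pdivrMr//; apply: smt_ge => // N' NN' _; rewrite ler_pdivrMr// mulrC.
    have xN' : x \in N' by exact: (fsubsetP NN').
    apply: le_trans (img g N' k x xN' k0 gX g_le); apply: smt_le => //.
      apply/fsubsetP => _ /imfsetP[y yN ->]; apply/imfsetP; exists y => //.
      exact: (fsubsetP NN').
    by move=> _ /imfsetP[y _ ->].
  apply: le_trans (steiner_ratio_le rho_ge0 M2 MX) _.
  rewrite ler_pdivrMr ?rho_mst_gt0// mulrAC ler_pdivlMr ?d_mst_gt0//.
  apply: le_trans (ler_wpM2r (mst_ge0 d_ge0 _) smt_le') _.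
  by rewrite -mulrA mulrCA ler_wpM2l// smt_ge0.
(* The reverse inequality. The copy of two points shows that [X] has a subset with two elements, so
   that the infimum over [X] is a genuine one. *)
- have [k [h [k0 hd hrho]]] := similar [fset w1; w2]%fset.
  have g_inj := sim_inj k h _ k0 hrho.
  pose M1 := [fset f (h y) | y in [fset w1; w2]]%fset.
  have M1_card : (2 <= #|` M1|)%N by rewrite card_in_imfset.
  have M1X : [set` M1] `<=` X by move=> _ /imfsetP[y _ ->]; exact: fX.
  apply: (steiner_ratio_ge M1_card M1X) => M M2 MX.
  have [p pM] := elt _ _ M2.
  rewrite ler_pdivlMr ?rho_mst_gt0//.
  apply: smt_ge => // N MN NX; apply/ler_addgt0Pr => e e0.
  have pN : p \in N by exact: (fsubsetP MN).
  have e2 : 0 < e / 2 by rewrite divr_gt0.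
  have [S [l [gS eS lt_l]]] := mst_growth_lt rho_ge0 (rhoC N NX) pN e2.
  (* Adding 1 makes [n] positive; the slack [e / 2 / n] per edge totals at most [e / 2]. *)
  pose n : R := (size S)%:R + 1.
  have n0 : 0 < n by rewrite ltr_wpDl.
  have [||S' [l' [gS' eS' le_l]]] := growth_lift (rho := rho) (d := d) (f := f) (e := e / 2 / n) gS.
  - by move=> q; rewrite eS => qN; apply: surj; exact: NX.
  - by move=> x q; rewrite eS => qN; apply: lift; [exact: NX | rewrite divr_gt0].
  have le_l' : l' <= mst rho N + e.
    have : (size S).-1%:R * (e / 2 / n) <= e / 2.
      rewrite mulrCA ler_piMr ?(ltW e2)// ler_pdivrMr// mul1r /n.
      by rewrite (@le_trans _ _ (size S)%:R) ?lerDl// ler_nat leq_pred.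
    by move: le_l lt_l; lra.
  apply: le_trans le_l'.
  (* The lifted tree spans [N'], a Steiner set for its part [M'] over [M]; since [M'] projects onto
     [M], its minimal spanning tree is at least as long as that of [M]. *)
  pose N' := [fset x in S']%fset.
  pose M' := [fset x in S' | f x \in M]%fset.
  have N'E x : (x \in N') = (x \in S') by rewrite !inE.
  have M'E x : (x \in M') = (x \in S') && (f x \in M) by rewrite !inE.
  have M'sur q : q \in M -> exists2 x, x \in M' & q = f x.
    move=> qM; have : q \in map f S' by rewrite eS' eS; exact: (fsubsetP MN).
    by case/mapP => x xS' qfx; exists x => //; rewrite M'E xS' -qfx.
  have M'M : [fset f x | x in M']%fset = M.
    apply/fsetP => q; apply/imfsetP/idP => [[x /=]|/M'sur[x xM' ->]]; last by exists x.
    by rewrite M'E => /andP[_ fxM] ->.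
  have M'2 : (2 <= #|` M'|)%N.
    by rewrite (leq_trans M2)// -M'M leq_imfset_card.
  have [x xM' px] := M'sur _ pM.
  have mst_le : mst rho M <= mst d M'.
    rewrite -M'M -(mul1r (mst d M')); apply: img xM' _ _ _ => //.
    by move=> y z; rewrite mul1r.
  apply: le_trans (ler_wpM2l (steiner_ratio_ge0 d_ge0 _) mst_le) _.
  rewrite -ler_pdivlMr ?d_mst_gt0//.
  apply: le_trans (steiner_ratio_le d_ge0 M'2 (@subsetT _ _)) _.
  rewrite ler_pM2r ?invr_gt0 ?d_mst_gt0//.
  have M'N' : (M' `<=` N')%fset by apply/fsubsetP => y; rewrite M'E N'E => /andP[].
  apply: le_trans (smt_le d_ge0 M'N' (@subsetT _ _)) _.
  exact: (mst_le_growth d_ge0 (dCM _) gS').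
Qed.

End Folding.

(** * The Euclidean inner product and distance *)

Section EuclideanDistance.
Context {R : realType} {n : nat}.
Implicit Types (x y z p q r : 'rV[R]_n).

Definition dot x y : R := \sum_i x 0 i * y 0 i.

Lemma dotC x y : dot x y = dot y x.
Proof. by apply: eq_bigr => i _; rewrite mulrC. Qed.

Lemma dotDl x y z : dot (x + y) z = dot x z + dot y z.
Proof. by rewrite -big_split; apply: eq_bigr => i _; rewrite mxE mulrDl. Qed.

Lemma dotZl a x y : dot (a *: x) y = a * dot x y.
Proof. by rewrite mulr_sumr; apply: eq_bigr => i _; rewrite mxE mulrA. Qed.

Lemma dotNl x y : dot (- x) y = - dot x y.
Proof. by rewrite -scaleN1r dotZl mulN1r. Qed.

Lemma dotDr x y z : dot x (y + z) = dot x y + dot x z.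
Proof. by rewrite dotC dotDl !(dotC _ x). Qed.

Lemma dotZr a x y : dot x (a *: y) = a * dot x y.
Proof. by rewrite dotC dotZl dotC. Qed.

Lemma dotNr x y : dot x (- y) = - dot x y.
Proof. by rewrite dotC dotNl dotC. Qed.

Definition dotE := (dotDl, dotDr, dotNl, dotNr, dotZl, dotZr).

Lemma dot_ge0 x : 0 <= dot x x.
Proof. by apply: sumr_ge0 => i _; rewrite -expr2 sqr_ge0. Qed.

Lemma dot_eq0 x : (dot x x == 0) = (x == 0).
Proof.
apply/eqP/eqP => [|->]; last by rewrite /dot big1// => i _; rewrite mxE mul0r.
move=> /eqP; rewrite psumr_eq0 => [/allP x0|i _]; last by rewrite -expr2 sqr_ge0.
apply/rowP => i; have := x0 i; rewrite mem_index_enum mxE mulf_eq0 orbb => /(_ isT).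
by move=> /eqP.
Qed.

Lemma dot_gt0 x : (0 < dot x x) = (x != 0).
Proof. by rewrite lt_def dot_ge0 andbT dot_eq0. Qed.

Lemma euclid_distE x y : euclid_dist x y = Num.sqrt (dot (x - y) (x - y)).
Proof. by congr Num.sqrt; apply: eq_bigr => i _; rewrite !mxE expr2. Qed.

Lemma euclid_dist_sqr x y : euclid_dist x y ^+ 2 = dot (x - y) (x - y).
Proof. by rewrite euclid_distE sqr_sqrtr ?dot_ge0. Qed.

Lemma euclid_dist_ge0 x y : 0 <= euclid_dist x y.
Proof. exact: sqrtr_ge0. Qed.

Lemma euclid_distxx x : euclid_dist x x = 0.
Proof. by rewrite euclid_distE subrr (eqP (_ : dot 0 0 == 0)) ?sqrtr0// dot_eq0. Qed.

Lemma euclid_distC x y : euclid_dist x y = euclid_dist y x.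
Proof. by rewrite !euclid_distE -opprB dotNl dotNr opprK. Qed.

Lemma euclid_dist_gt0 x y : x != y -> 0 < euclid_dist x y.
Proof. by move=> xy; rewrite euclid_distE sqrtr_gt0 dot_gt0 subr_eq0. Qed.

(** Cauchy-Schwarz, from the squared norm of [dot y y *: x - dot x y *: y]. *)
Lemma dot_le_sqrt x y :
  dot x y <= Num.sqrt (dot x x) * Num.sqrt (dot y y).
Proof.
have [/eqP|y0] := eqVneq (dot y y) 0.
  rewrite dot_eq0 => /eqP->; have -> : dot x 0 = 0 by rewrite -(scale0r 0) dotZr mul0r.
  by rewrite mulr_ge0 ?sqrtr_ge0.
have y_gt0 : 0 < dot y y by rewrite lt_def y0 dot_ge0.
rewrite -sqrtrM ?dot_ge0//; apply: le_trans (ler_norm _) _.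
rewrite -sqrtr_sqr ler_wsqrtr//.
have := dot_ge0 (dot y y *: x - dot x y *: y).
rewrite !dotE (dotC y x) => H.
have : 0 <= dot y y * (dot x x * dot y y - dot x y ^+ 2) by move: H; rewrite expr2; lra.
by rewrite pmulr_rge0// subr_ge0.
Qed.

Lemma euclid_dist_triangle x y z :
  euclid_dist x z <= euclid_dist x y + euclid_dist y z.
Proof.
rewrite -(@ler_pXn2r _ 2)// ?nnegrE ?addr_ge0 ?euclid_dist_ge0//.
rewrite sqrrD !euclid_dist_sqr !euclid_distE.
have -> : x - z = (x - y) + (y - z) by rewrite addrA subrK.
move: (x - y) (y - z) => p q; rewrite !dotE (dotC q p).
have := dot_le_sqrt p q; lra.
Qed.

Lemma euclid_dist_conv (I : finType) (P : pred I) (w : I -> R) (p : I -> 'rV[R]_n) x :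
  (forall i, 0 <= w i) -> \sum_(i | P i) w i = 1 ->
  euclid_dist (\sum_(i | P i) w i *: p i) x <= \sum_(i | P i) w i * euclid_dist (p i) x.
Proof.
move=> w0 w1; rewrite -{1}[x]scale1r -w1 scaler_suml.
apply: (big_rec3 (fun y z l => euclid_dist y z <= l)); first by rewrite euclid_distxx.
move=> i y z l _ le_l.
apply: le_trans (euclid_dist_triangle _ (w i *: x + y) _) _; apply: lerD.
  rewrite !euclid_distE opprD addrACA subrr addr0 -scalerBr dotZl dotZr mulrA -expr2.
  by rewrite sqrtrM ?sqr_ge0// sqrtr_sqr ger0_norm.
apply: le_trans le_l.
by rewrite !euclid_distE opprD addrACA subrr add0r.
Qed.

Lemma euclid_dist_le_norm x y : euclid_dist x y <= n%:R * `|x - y|.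
Proof.
rewrite euclid_distE -[leRHS]ger0_norm ?mulr_ge0// -sqrtr_sqr ler_wsqrtr//.
rewrite exprMn; apply: (@le_trans _ _ (\sum_(i < n) `|x - y| ^+ 2)).
  apply: ler_sum => i _; rewrite -expr2 -real_normK ?num_real// ler_sqr ?nnegrE//.
  rewrite [leRHS]/Num.Def.normr /= mx_normrE; apply/bigmax_geP; right => /=.
  by exists (0, i).
rewrite sumr_const card_ord -[_ *+ n]mulr_natl ler_wpM2r ?sqr_ge0//.
by rewrite -natrX ler_nat; case: (n) => // m; rewrite leq_pmulr.
Qed.

Lemma coord_le_euclid_dist x y i : `|x 0 i - y 0 i| <= euclid_dist x y.
Proof.
rewrite euclid_distE -sqrtr_sqr ler_wsqrtr// /dot (bigD1 i)//= !mxE -expr2 lerDl.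
by rewrite sumr_ge0// => j _; rewrite -expr2 sqr_ge0.
Qed.

Lemma norm_le_euclid_dist x y : `|x - y| <= euclid_dist x y.
Proof.
have [->|] := eqVneq `|x - y| 0; first exact: euclid_dist_ge0.
case/mx_norm_neq0 => -[i j] nij; rewrite [leLHS]nij/= ord1 !mxE.
exact: coord_le_euclid_dist.
Qed.

End EuclideanDistance.

(** * The triangle wave and the tiling of the plane by triangles over the faces *)

Section TriangleWave.
Context {R : realType}.
Implicit Types (x y u v a s t : R).

(* The even piecewise linear function of period 2 with [wave 0 = 1] and
   [wave 1 = -1]. *)
Definition wave x : R := 1 - 2 * `|x - 2 * (Num.floor ((x + 1) / 2))%:~R|.

Lemma wave_repr x : exists (k : int) u, x = 2 * k%:~R + u /\ -1 <= u <= 1.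
Proof.
exists (Num.floor ((x + 1) / 2)), (x - 2 * (Num.floor ((x + 1) / 2))%:~R).
split; first by rewrite addrC subrK.
have := floor_itv ((x + 1) / 2); rewrite intrD1 => /andP[].
by set k := _%:~R; lra.
Qed.

Lemma waveE (k : int) u : -1 <= u <= 1 -> wave (2 * k%:~R + u) = 1 - 2 * `|u|.
Proof.
(* At [u = 1] the floor is already [k + 1] and the offset becomes -1, with the same absolute
   value. *)
move=> /andP[u_ge]; rewrite le_eqVlt => /predU1P[->|u_lt]; rewrite /wave.
  have -> : Num.floor ((2 * k%:~R + 1 + 1) / 2 : R) = k + 1.
    apply: floor_def; rewrite !intrD !mulr1z; apply/andP; split; lra.
  rewrite intrD mulr1z (_ : 2 * _ + 1 - _ = -1); last by lra.
  by rewrite normrN.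
have -> : Num.floor ((2 * k%:~R + u + 1) / 2 : R) = k.
  by apply: floor_def; rewrite !intrD !mulr1z; apply/andP; split; lra.
by rewrite addrAC subrr add0r.
Qed.

Lemma wave_le1 x : -1 <= wave x <= 1.
Proof.
have [k [u [-> u1]]] := wave_repr x; rewrite waveE//.
by case: (ger0P u); move: u1; lra.
Qed.

Lemma wave_lipschitz x y : `|wave x - wave y| <= 2 * `|x - y|.
Proof.
suff H a b : wave a - wave b <= 2 * `|a - b|.
  by rewrite ler_norml H andbT lerNl opprB distrC H.
have [k [u [-> u1]]] := wave_repr a; have [l [v [-> v1]]] := wave_repr b.
rewrite !waveE//.
have [->|kl] := eqVneq k l.
  rewrite (_ : _ + u - (_ + v) = u - v); last by lra.
  by case: (ger0P u); case: (ger0P v); case: (ger0P (u - v)); lra.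
have : (1 : R) <= `|k%:~R - l%:~R|.
  by rewrite -intrB -intr_norm -[1]/(1%:~R) ler_int -gtz0_ge1 normr_gt0 subr_eq0.
set K : R := k%:~R; set L : R := l%:~R.
by case: (ger0P u); case: (ger0P v); case: (ger0P (K - L));
   case: (ger0P (2 * K + u - (2 * L + v))); move: u1 v1; lra.
Qed.

(* At [x] the wave has, on at least one side, slope [2 * e] until the next extremum. *)
Definition wave_branch (e x : R) :=
  forall a, -1 <= a <= 1 -> wave (x + e * (a - wave x) / 2) = a.

Lemma wave_rising (k : int) u x : x = 2 * k%:~R + u -> -1 <= u <= 0 ->
  wave x = 1 + 2 * u /\ wave_branch 1 x.
Proof.
move=> -> u0; have wu : wave (2 * k%:~R + u) = 1 + 2 * u.
  by rewrite waveE ?ler0_norm; lra.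
split=> // a a1; rewrite wu mul1r.
rewrite (_ : _ + _ / 2 = 2 * k%:~R + (a - 1) / 2); last by lra.
by rewrite waveE ?ler0_norm; lra.
Qed.

Lemma wave_falling (k : int) u x : x = 2 * k%:~R + u -> 0 <= u <= 1 ->
  wave x = 1 - 2 * u /\ wave_branch (-1) x.
Proof.
move=> -> u0; have wu : wave (2 * k%:~R + u) = 1 - 2 * u.
  by rewrite waveE ?ger0_norm; lra.
split=> // a a1; rewrite wu.
rewrite (_ : _ + _ / 2 = 2 * k%:~R + (1 - a) / 2); last by lra.
by rewrite waveE ?ger0_norm; lra.
Qed.

(** A rising and a falling branch meet at each extremum; at [u = 1] and [u = -1] one of them belongs
    to the neighbouring period. *)
Lemma wave_turning x e : wave x = 1 \/ wave x = -1 -> e = 1 \/ e = -1 -> wave_branch e x.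
Proof.
have [k [u [xE u1]]] := wave_repr x; rewrite {1 2}xE waveE// => w1.
have [u0|[u0|u0]] : u = 0 \/ u = 1 \/ u = -1.
- case: (ger0P u) w1 => u0 [] w1.
  + by left; lra.
  + by right; left; lra.
  + by left; lra.
  + by right; right; lra.
- have [|_ r] := wave_rising xE; first lra.
  have [|_ f] := wave_falling xE; first lra.
  by case=> ->.
- have [|_ f] := wave_falling xE; first lra.
  have [||_ r] := @wave_rising (k + 1) (-1) x; [rewrite intrD mulr1z; lra| lra|].
  by case=> ->.
- have [|_ r] := wave_rising xE; first lra.
  have [||_ f] := @wave_falling (k - 1) 1 x; [rewrite intrB mulr1z; lra| lra|].
  by case=> ->.
Qed.

(* The vertices of the box circumscribed about the tetrahedron are the sign vectors;
   those with product 1 are the vertices of the tetrahedron, and the face opposite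
   to the vertex [i] lies in the plane where the product with its sign vector is -1. *)
Definition signA (i : 'I_4) : R := [:: 1; 1; -1; -1]`_i.
Definition signB (i : 'I_4) : R := [:: 1; -1; 1; -1]`_i.
Definition signC (i : 'I_4) : R := [:: 1; -1; -1; 1]`_i.

Definition face_form i (a b c : R) := signA i * a + signB i * b + signC i * c.

(* On a triangle lying over the face [i], the waves at [t], [s] and [s + t] have
   slopes proportional to [signA i], [signB i] and [- signC i], so that [face_form i]
   is constant there. *)
Definition on_tile (i : 'I_4) s t := exists2 e : R, e = 1 \/ e = -1 &
  [/\ wave_branch (e * signA i) t, wave_branch (e * signB i) s
    & wave_branch (- (e * signC i)) (s + t)].

(** The offsets [u], [v] range over a square of side 2, cut into eight triangles by the lines where
    [u], [v] or [u + v] is an integer. Each face lies under two of them, with opposite signs [e]. *)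
Lemma tile_exists s t : exists2 i,
  face_form i (wave t) (wave s) (wave (s + t)) = -1 & on_tile i s t.
Proof.
have [k [u [sE u1]]] := wave_repr s; have [l [v [tE v1]]] := wave_repr t.
have stE : s + t = 2 * (k + l)%:~R + (u + v).
  by rewrite sE tE !intrD; lra.
have stE1 : s + t = 2 * (k + l + 1)%:~R + (u + v - 2).
  by rewrite sE tE !intrD mulr1z; lra.
have stEN : s + t = 2 * (k + l - 1)%:~R + (u + v + 2).
  by rewrite sE tE intrB intrD mulr1z; lra.
have tile (i : 'I_4) e a b c : e = 1 \/ e = -1 ->
    wave t = a /\ wave_branch (e * signA i) t ->
    wave s = b /\ wave_branch (e * signB i) s ->
    wave (s + t) = c /\ wave_branch (- (e * signC i)) (s + t) ->
    face_form i a b c = -1 ->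
    exists2 i, face_form i (wave t) (wave s) (wave (s + t)) = -1 & on_tile i s t.
  by move=> e1 [-> At] [-> Bs] [-> Cst] abc; exists i => //; exists e.
have [u0|u0] := leP 0 u; have [v0|v0] := leP 0 v.
- have t_ := wave_falling tE; have s_ := wave_falling sE.
  have [uv|uv] := leP (u + v) 1.
  + have st_ := wave_falling stE.
    apply: (tile (@Ordinal 4 3 isT) 1) => /=.
    * by left.
    * by rewrite mul1r; apply: t_; lra.
    * by rewrite mul1r; apply: s_; lra.
    * by rewrite mul1r; apply: st_; lra.
    * by rewrite /face_form /signA /signB /signC /=; lra.
  + have st_ := wave_rising stE1.
    apply: (tile (@Ordinal 4 0 isT) (-1)) => /=.
    * by right.
    * by rewrite mulr1; apply: t_; lra.
    * by rewrite mulr1; apply: s_; lra.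
    * by rewrite mulr1 opprK; apply: st_; lra.
    * by rewrite /face_form /signA /signB /signC /=; lra.
- have t_ := wave_rising tE; have s_ := wave_falling sE.
  have [uv|uv] := leP 0 (u + v).
  + have st_ := wave_falling stE.
    apply: (tile (@Ordinal 4 2 isT) (-1)) => /=.
    * by right.
    * by rewrite mulrNN mulr1; apply: t_; lra.
    * by rewrite mulr1; apply: s_; lra.
    * by rewrite mulrNN mulr1; apply: st_; lra.
    * by rewrite /face_form /signA /signB /signC /=; lra.
  + have st_ := wave_rising stE.
    apply: (tile (@Ordinal 4 1 isT) 1) => /=.
    * by left.
    * by rewrite mul1r; apply: t_; lra.
    * by rewrite mul1r; apply: s_; lra.
    * by rewrite mul1r opprK; apply: st_; lra.
    * by rewrite /face_form /signA /signB /signC /=; lra.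
- have t_ := wave_falling tE; have s_ := wave_rising sE.
  have [uv|uv] := leP 0 (u + v).
  + have st_ := wave_falling stE.
    apply: (tile (@Ordinal 4 1 isT) (-1)) => /=.
    * by right.
    * by rewrite mulr1; apply: t_; lra.
    * by rewrite mulrNN mulr1; apply: s_; lra.
    * by rewrite mulrNN mulr1; apply: st_; lra.
    * by rewrite /face_form /signA /signB /signC /=; lra.
  + have st_ := wave_rising stE.
    apply: (tile (@Ordinal 4 2 isT) 1) => /=.
    * by left.
    * by rewrite mul1r; apply: t_; lra.
    * by rewrite mul1r; apply: s_; lra.
    * by rewrite mul1r opprK; apply: st_; lra.
    * by rewrite /face_form /signA /signB /signC /=; lra.
- have t_ := wave_rising tE; have s_ := wave_rising sE.
  have [uv|uv] := leP (-1) (u + v).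
  + have st_ := wave_rising stE.
    apply: (tile (@Ordinal 4 3 isT) (-1)) => /=.
    * by right.
    * by rewrite mulrNN mulr1; apply: t_; lra.
    * by rewrite mulrNN mulr1; apply: s_; lra.
    * by rewrite mulr1 opprK; apply: st_; lra.
    * by rewrite /face_form /signA /signB /signC /=; lra.
  + have st_ := wave_falling stEN.
    apply: (tile (@Ordinal 4 0 isT) 1) => /=.
    * by left.
    * by rewrite mulr1; apply: t_; lra.
    * by rewrite mulr1; apply: s_; lra.
    * by rewrite mulr1; apply: st_; lra.
    * by rewrite /face_form /signA /signB /signC /=; lra.
Qed.

(** If [tile_exists] returns a different face [j], the point lies over the edge common to both
    faces, and the tile across that edge lies over [i]. *)
Lemma on_tile_face i s t :
  face_form i (wave t) (wave s) (wave (s + t)) = -1 -> on_tile i s t.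
Proof.
have [j + [e e1 [At Bs Cst]]] := tile_exists s t.
rewrite /face_form; set a := wave t; set b := wave s; set c := wave (s + t).
have turn x w : wave x = 1 \/ wave x = -1 -> w = 1 \/ w = -1 -> wave_branch w x.
  exact: wave_turning.
have [->|ij] := eqVneq i j; first by move=> _ _; exists e.
move=> F1 F2.
(* Two faces meet along an edge, where one of the three coordinates is extremal. *)
suff H : [/\ wave_branch (- e * signA i) t, wave_branch (- e * signB i) s
    & wave_branch (- (- e * signC i)) (s + t)].
  by exists (- e) => //; case: e1 => ->; [right|left]; rewrite ?opprK.
rewrite -val_eqE in ij.
move: ij At Bs Cst F1 F2; case: i => [[|[|[|[|//]]]] ?]; case: j => [[|[|[|[|//]]]] ?] //=.
all: rewrite /signA /signB /signC /= => _ At Bs Cst F1 F2; split.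
(* Distinct sign vectors differ in exactly two entries, where [- e] restores the branches known for
   [j]. In the third entry the wave is extremal, so [turn] applies. *)
all: try by [move: At; rewrite ?(mulNr, mulrN, opprK)|
             move: Bs; rewrite ?(mulNr, mulrN, opprK)|
             move: Cst; rewrite ?(mulNr, mulrN, opprK)].
all: apply: turn.
all: try by case: e1 => ->; [left; lra | right; lra].
all: try by case: e1 => ->; [right; lra | left; lra].
all: rewrite -/a -/b -/c.
all: by [left; lra | right; lra].
Qed.

(** Each coordinate moves along a branch of slope 2 or -2, whence the factor 4 between the
    squares. *)
Lemma fold_lift i s t a b c :
  -1 <= a <= 1 -> -1 <= b <= 1 -> -1 <= c <= 1 -> face_form i a b c = -1 ->
  face_form i (wave t) (wave s) (wave (s + t)) = -1 ->
  exists s' t', [/\ wave t' = a, wave s' = b, wave (s' + t') = c &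
    [/\ 4 * (t - t') ^+ 2 = (a - wave t) ^+ 2, 4 * (s - s') ^+ 2 = (b - wave s) ^+ 2
      & 4 * (s + t - (s' + t')) ^+ 2 = (c - wave (s + t)) ^+ 2]].
Proof.
move=> a1 b1 c1 abc st; have [e e1 [At Bs Cst]] := on_tile_face st.
have sq (x w y z : R) : w = 1 \/ w = -1 -> y = x + w * z / 2 ->
    4 * (x - y) ^+ 2 = z ^+ 2 :> R.
  by move=> [->|->] ->; rewrite !expr2; lra.
have sg w (i' : 'I_4) : w = 1 \/ w = -1 ->
    [/\ w * signA i' = 1 \/ w * signA i' = -1, w * signB i' = 1 \/ w * signB i' = -1
      & - (w * signC i') = 1 \/ - (w * signC i') = -1].
  by case: i' => [[|[|[|[|//]]]] ?]; rewrite /signA /signB /signC /= => -[->|->]; split;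
    first [left; lra | right; lra].
have [eA eB eC] := sg e i e1.
pose t' := t + e * signA i * (a - wave t) / 2.
pose s' := s + e * signB i * (b - wave s) / 2.
(* Both points satisfy the equation of the face, so the signed changes of the three waves cancel;
   hence [s' + t'] follows its own branch too. *)
have st' : s' + t' = s + t + - (e * signC i) * (c - wave (s + t)) / 2.
  by move: abc st; rewrite /face_form /s' /t' => abc st; nra.
exists s', t'; split; [exact: At | exact: Bs | by rewrite st'; exact: Cst |].
by split; [exact: sq eA _ | exact: sq eB _ | exact: sq eC st'].
Qed.

End TriangleWave.

(** * Lengths of curves, the intrinsic distance and the lifting of curves *)

Section Curves.
Context {R : realType}.

(** At the supremum [u] of the points satisfying [P], the step brings [P] from a nearby point on the
    left to [u], and then beyond [u] unless [u = 1]. *)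
Lemma real_induction (P : R -> Prop) : P 0 ->
  (forall u, 0 <= u <= 1 -> exists2 e, 0 < e & forall t, 0 <= t <= 1 -> `|t - u| < e ->
     (t < u -> P t -> P u) /\ (u < t -> P u -> P t)) ->
  P 1.
Proof.
move=> P0 step; pose E := [set t : R | 0 <= t <= 1 /\ P t].
have supE : has_sup E.
  by split; [exists 0; split=> //; rewrite lexx ler01 | exists 1 => t [/andP[]]].
pose u := sup E.
have le_u t : E t -> t <= u by exact: sup_upper_bound.
have u0 : 0 <= u by apply: le_u; split=> //; rewrite lexx ler01.
have u1 : u <= 1 by apply: ge_sup supE.1 _ => t [/andP[]].
have [|e e0 He] := step u; first by rewrite u0.
have Pu : P u.
  have [t [t01 Pt] ut] := sup_adherent e0 supE.
  have tu : t <= u by apply: le_u.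
  move: tu; rewrite le_eqVlt => /predU1P[<-//|tu].
  have [||+ _] := He t; [by [] | rewrite ltr0_norm ?subr_lt0//; move: ut; rewrite -/u; lra |].
  exact.
have [<-//|u_neq1] := eqVneq u 1.
have u_lt1 : u < 1 by rewrite lt_neqAle u_neq1.
pose t := Num.min 1 (u + e / 2).
have ut : u < t by rewrite /t lt_min u_lt1/=; lra.
have t1 : t <= 1 by rewrite ge_min lexx.
have te : t <= u + e / 2 by rewrite ge_min lexx orbT.
have [||_ H] := He t; [by lra | by rewrite gtr0_norm ?subr_gt0//; lra|].
have : t <= u by apply: le_u; split; [lra | exact: H].
by rewrite leNgt ut.
Qed.

Context {n : nat}.
Implicit Types (g : R -> 'rV[R]_n) (T : set 'rV[R]_n).

(** [inscribed_length] with an arbitrary starting point instead of 0, to allow induction on the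
    partition. *)
Definition chain_length g a (s : seq R) : R :=
  \sum_(0 <= i < size s)
    euclid_dist (g (nth 1 (a :: s) i)) (g (nth 1 (a :: s) i.+1)).

Lemma chain_length_cons g a b s :
  chain_length g a (b :: s) = euclid_dist (g a) (g b) + chain_length g b s.
Proof. by rewrite /chain_length /= big_nat_recl. Qed.

Lemma chain_length_nil g a : chain_length g a [::] = 0.
Proof. by rewrite /chain_length big_nil. Qed.

Lemma chain_length_rcons g a b s :
  chain_length g a (rcons s b) = chain_length g a s + euclid_dist (g (last a s)) (g b).
Proof.
elim: s a => [|c s IH] a /=; last by rewrite !chain_length_cons IH addrA.
by rewrite chain_length_cons !chain_length_nil addr0 add0r.
Qed.

Lemma chain_length_lipschitz g a s L :
  (forall t u, 0 <= t <= 1 -> 0 <= u <= 1 -> euclid_dist (g t) (g u) <= L * `|t - u|) ->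
  0 <= a -> path <%R a s -> last a s <= 1 ->
  chain_length g a s <= L * (last a s - a).
Proof.
move=> lip; elim: s a => [|b s IH] a a0 /=.
  by move=> _ _; rewrite chain_length_nil subrr mulr0.
move=> /andP[ab bs] l1; rewrite chain_length_cons.
have b_last : b <= last b s by apply: (@itv_partition_le _ _ b _ s); split.
have := IH b _ bs l1; have := lip a b _ _.
rewrite distrC gtr0_norm ?subr_gt0//.
set M := L * _; set M' := L * _; set M'' := L * _.
have -> : M'' = M + M' by rewrite /M /M' /M''; lra.
by move=> /(_ _ _)-H1 /(_ _)-H2; apply: lerD; [apply: H1; lra | apply: H2; lra].
Qed.

Lemma curve_length_ge g : ((euclid_dist (g 0) (g 1))%:E <= curve_length g)%E.
Proof.
apply: ereal_sup_ubound; exists [:: 1]; first exact: itv_partition1.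
by rewrite -[inscribed_length _ _]/(chain_length g 0 [:: 1]) chain_length_cons
  chain_length_nil addr0.
Qed.

Lemma curve_length_lipschitz g L :
  (forall t u, 0 <= t <= 1 -> 0 <= u <= 1 -> euclid_dist (g t) (g u) <= L * `|t - u|) ->
  (curve_length g <= L%:E)%E.
Proof.
move=> lip; apply/ereal_supP => _ [s [ps /eqP ls] <-]; rewrite lee_fin.
rewrite -[inscribed_length _ _]/(chain_length g 0 s).
by have := chain_length_lipschitz lip (lexx 0) ps; rewrite ls subr0 mulr1; apply.
Qed.

Lemma intrinsic_dist_ge0 T x y : 0 <= intrinsic_dist T x y.
Proof.
apply: fine_ge0; apply/ereal_infP => _ [g _ <-].
by apply: le_trans (curve_length_ge g); rewrite lee_fin euclid_dist_ge0.
Qed.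

(** One curve of finite length makes the infimum finite, so [fine] loses nothing. *)
Lemma intrinsic_distE T x y g L : curve_in T x y g -> (curve_length g <= L%:E)%E ->
  (intrinsic_dist T x y)%:E = ereal_inf [set curve_length g | g in curve_in T x y].
Proof.
move=> cg lg; rewrite /intrinsic_dist fineK// ge0_fin_numE.
  by apply: le_lt_trans (ltry L); apply: le_trans lg; apply: ereal_inf_lbound; exists g.
apply/ereal_infP => _ [h _ <-].
by apply: le_trans (curve_length_ge h); rewrite lee_fin euclid_dist_ge0.
Qed.

Lemma euclid_dist_le_intrinsic T x y g L :
  curve_in T x y g -> (curve_length g <= L%:E)%E ->
  euclid_dist x y <= intrinsic_dist T x y.
Proof.
move=> cg lg; rewrite -lee_fin (intrinsic_distE cg lg).
apply/ereal_infP => _ [h [_ <- <- _] <-]; exact: curve_length_ge.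
Qed.

Lemma intrinsic_dist_le T x y g L :
  curve_in T x y g -> (curve_length g <= L%:E)%E -> intrinsic_dist T x y <= L.
Proof.
move=> cg lg; rewrite -lee_fin (intrinsic_distE cg lg).
by apply: le_trans lg; apply: ereal_inf_lbound; exists g.
Qed.

Lemma within_continuous_dist g u e : {within `[0, 1], continuous g} -> 0 <= u <= 1 ->
  0 < e -> exists2 dl, 0 < dl & forall t, 0 <= t <= 1 -> `|t - u| < dl ->
    euclid_dist (g t) (g u) < e.
Proof.
move=> /subspace_continuousP cg u01 e0.
have := cg u; rewrite /= in_itv/= u01 => /(_ isT)/cvgrPdist_lt.
have n0 : 0 < n%:R + 1 :> R by rewrite ltr_wpDl.
move=> /(_ (e / (n%:R + 1))); rewrite divr_gt0// => /(_ isT).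
rewrite near_withinE => /nbhs_ballP[dl dl0 H].
exists dl => // t t01 tu; apply: le_lt_trans (euclid_dist_le_norm _ _) _.
have {}H : `|g u - g t| < e / (n%:R + 1).
  by apply: H; rewrite /ball/= ?in_itv//= distrC.
rewrite distrC; apply: (@le_lt_trans _ _ ((n%:R + 1) * `|g u - g t|)).
  by rewrite ler_wpM2r// lerDl.
by rewrite mulrC -ltr_pdivlMr.
Qed.

Lemma lipschitz_within_continuous g L :
  (forall t u, 0 <= t <= 1 -> 0 <= u <= 1 -> euclid_dist (g t) (g u) <= L * `|t - u|) ->
  {within `[0, 1], continuous g}.
Proof.
move=> lip; apply/subspace_continuousP => u; rewrite /= in_itv/= => u01.
apply/cvgrPdist_lt => e e0; rewrite near_withinE; apply/nbhs_ballP.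
have L0 : 0 < `|L| + 1 by rewrite ltr_wpDl.
exists (e / (`|L| + 1)) => /=; first by rewrite divr_gt0.
move=> t; rewrite /ball/= in_itv/= ltr_pdivlMr// => tu t01.
apply: le_lt_trans (norm_le_euclid_dist _ _) _.
apply: le_lt_trans (lip _ _ u01 t01) _; apply: le_lt_trans tu.
by rewrite mulrC ler_wpM2l//; have := ler_norm L; lra.
Qed.

(** Only the points of a partition are lifted, each from the preceding one, at the cost of the
    chords. The two directions of the local hypothesis serve to reach a parameter from the left and
    to leave it to the right. *)
Lemma curve_lift (W : Type) (d : W -> W -> R) (f : W -> 'rV[R]_n) T x q g :
  d x x = 0 -> (forall y z, d x z <= d x y + d y z) ->
  (forall p, T p -> exists2 e, 0 < e & forall p', T p' -> euclid_dist p' p < e ->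
     (forall y, f y = p -> exists2 z, f z = p' & d y z <= euclid_dist p p') /\
     (forall y, f y = p' -> exists2 z, f z = p & d y z <= euclid_dist p' p)) ->
  curve_in T (f x) q g ->
  exists y, f y = q /\ ((d x y)%:E <= curve_length g)%E.
Proof.
move=> dxx dD loc [cg g0 g1 gT].
have gT' t : 0 <= t <= 1 -> T (g t) by move=> t01; apply: gT; rewrite in_itv.
pose P t := exists s y, [/\ path <%R 0 s, last 0 s = t, f y = g t & d x y <= chain_length g 0 s].
have ext s y t u : path <%R 0 s -> last 0 s = t -> f y = g t -> d x y <= chain_length g 0 s ->
    t < u -> (exists2 z, f z = g u & d y z <= euclid_dist (g t) (g u)) -> P u.
  move=> ps ls fy le_d tu [z fz le_z]; exists (rcons s u), z; split=> //.
  - by rewrite rcons_path ps ls.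
  - by rewrite last_rcons.
  - by rewrite chain_length_rcons ls (le_trans (dD y z))// lerD.
suff [s [y [ps ls fy le_d]]] : P 1.
  exists y; split; first by rewrite fy.
  apply: (@le_trans _ _ (chain_length g 0 s)%:E); first by rewrite lee_fin.
  by apply: ereal_sup_ubound; exists s => //; split=> //; exact/eqP.
apply: real_induction.
  by exists [::], x; rewrite g0 dxx chain_length_nil; split.
move=> u u01; have [e e0 He] := loc _ (gT' _ u01).
have [dl dl0 Hdl] := within_continuous_dist cg u01 e0.
exists dl => // t t01 tu; have [fwd bwd] := He _ (gT' _ t01) (Hdl _ t01 tu).
split=> [tu' [s [y [ps ls fy le_d]]]|ut [s [y [ps ls fy le_d]]]].
  exact: ext ps ls fy le_d tu' (bwd _ fy).
exact: ext ps ls fy le_d ut (fwd _ fy).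
Qed.

End Curves.

(** * Perimeters of triples of points *)

Section Perimeter.
Context {R : realType} {n : nat}.
Implicit Types (x y z : 'rV[R]_n).

Definition perimeter x y z := euclid_dist x y + euclid_dist y z + euclid_dist z x.

Lemma perimeterC x y z : perimeter x y z = perimeter y z x.
Proof. by rewrite /perimeter; lra. Qed.

Lemma perimeter_vertices (p : 'I_3 -> 'rV[R]_n) i j k :
  perimeter (p i) (p j) (p k) <= perimeter (p 0) (p 1) (p (lift ord0 1)).
Proof.
have ord3 (l : 'I_3) : [\/ l = 0, l = 1 | l = lift ord0 1].
  by case: l => [[|[|[|//]]] ?]; [constructor 1|constructor 2|constructor 3]; exact/val_inj.
set a := p 0; set b := p 1; set c := p (lift ord0 1).
have := euclid_dist_triangle a b c; have := euclid_dist_triangle b c a.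
have := euclid_dist_triangle c a b; rewrite /perimeter.
rewrite (euclid_distC c a) (euclid_distC b a) (euclid_distC c b).
have := euclid_dist_ge0 a b; have := euclid_dist_ge0 b c; have := euclid_dist_ge0 a c.
case: (ord3 i) => ->; case: (ord3 j) => ->; case: (ord3 k) => ->;
  rewrite -?/a -?/b -?/c ?euclid_distxx
    ?(euclid_distC c a) ?(euclid_distC b a) ?(euclid_distC c b); lra.
Qed.

(** The perimeter is convex in each of its points, as the distance is. *)
Lemma perimeter_conv (I : finType) (P : pred I) (w : I -> R) (p : I -> 'rV[R]_n) y z K :
  (forall i, 0 <= w i) -> \sum_(i | P i) w i = 1 ->
  (forall i, P i -> perimeter (p i) y z <= K) ->
  perimeter (\sum_(i | P i) w i *: p i) y z <= K.
Proof.
move=> w0 w1 le_K.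
apply: (@le_trans _ _ (\sum_(i | P i) w i * perimeter (p i) y z)).
  have -> : \sum_(i | P i) w i * perimeter (p i) y z =
      \sum_(i | P i) w i * euclid_dist (p i) y + euclid_dist y z
      + \sum_(i | P i) w i * euclid_dist (p i) z.
    rewrite -[euclid_dist y z]mul1r -w1 mulr_suml -!big_split/=.
    by apply: eq_bigr => i _; rewrite /perimeter !mulrDr (euclid_distC z).
  by rewrite /perimeter (euclid_distC z) !lerD// euclid_dist_conv.
rewrite -[K]mul1r -w1 mulr_suml; apply: ler_sum => i Pi.
by rewrite ler_wpM2l// le_K.
Qed.

End Perimeter.

(** * The isosceles tetrahedron and its circumscribed box *)

Section Tetrahedron.
Context {R : realType} (v : 'I_4 -> 'rV[R]_3).
Let o0 : 'I_4 := @Ordinal 4 0 isT.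
Let o1 : 'I_4 := @Ordinal 4 1 isT.
Let o2 : 'I_4 := @Ordinal 4 2 isT.
Let o3 : 'I_4 := @Ordinal 4 3 isT.

Definition face_perimeter (i : 'I_4) :=
  perimeter (v (lift i 0)) (v (lift i 1)) (v (lift i (lift ord0 1))).

Lemma face_vertex i j : j != i -> face v i (v j).
Proof.
move=> ji; exists (fun k => (k == j)%:R); split=> [k||].
- exact: ler0n.
- by rewrite (bigD1 j)//= eqxx big1 ?addr0// => k /andP[_ /negPf->].
- rewrite (bigD1 j)//= eqxx scale1r big1 ?addr0// => k /andP[_ /negPf->].
  by rewrite scale0r.
Qed.

(** By convexity the maximum is attained at vertices. The perimeter of a face thus becomes a metric
    invariant, available without knowing that a congruence maps vertices to vertices. *)
Lemma perimeter_le_face i x y z : face v i x -> face v i y -> face v i z ->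
  perimeter x y z <= face_perimeter i.
Proof.
move=> [w [w0 w1 ->]] [w' [w0' w1' ->]] [w'' [w0'' w1'' ->]].
apply: perimeter_conv => // j ji; rewrite perimeterC.
apply: perimeter_conv => // k ki; rewrite perimeterC.
apply: perimeter_conv => // l li; rewrite perimeterC.
rewrite eq_sym in ji; rewrite eq_sym in ki; rewrite eq_sym in li.
have [j' -> _] := unlift_some ji; have [k' -> _] := unlift_some ki.
have [l' -> _] := unlift_some li.
exact: (perimeter_vertices (v \o lift i)).
Qed.

Lemma congruent_face_perimeter i j :
  congruent (face v i) (face v j) -> face_perimeter i <= face_perimeter j.
Proof.
move=> [f [isof fE]].
have fv k : face v j (f (v (lift i k))).
  by rewrite -fE; exists (v (lift i k)) => //; apply: face_vertex; rewrite eq_sym neq_lift.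
apply: le_trans (perimeter_le_face (fv 0) (fv 1) (fv (lift ord0 1))).
by rewrite /face_perimeter /perimeter !isof.
Qed.

(* Adding the perimeters of the two faces through an edge and subtracting those of
   the other two leaves twice the difference of two opposite edges. *)
Lemma isosceles_opposite_edges : isosceles v ->
  [/\ euclid_dist (v o0) (v o1) = euclid_dist (v o2) (v o3),
      euclid_dist (v o0) (v o2) = euclid_dist (v o1) (v o3)
    & euclid_dist (v o0) (v o3) = euclid_dist (v o1) (v o2)].
Proof.
move=> iso; have P i j : face_perimeter i = face_perimeter j.
  by apply/eqP; rewrite eq_le !congruent_face_perimeter//; exact: iso.
have L (i j : 'I_4) (k : 'I_3) : lift i k = j :> nat -> v (lift i k) = v j.
  by move=> e; congr v; exact: val_inj.
have P0 : face_perimeter o0 = perimeter (v o1) (v o2) (v o3).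
  by rewrite /face_perimeter (L _ o1)// (L _ o2)// (L _ o3).
have P1 : face_perimeter o1 = perimeter (v o0) (v o2) (v o3).
  by rewrite /face_perimeter (L _ o0)// (L _ o2)// (L _ o3).
have P2 : face_perimeter o2 = perimeter (v o0) (v o1) (v o3).
  by rewrite /face_perimeter (L _ o0)// (L _ o1)// (L _ o3).
have P3 : face_perimeter o3 = perimeter (v o0) (v o1) (v o2).
  by rewrite /face_perimeter (L _ o0)// (L _ o1)// (L _ o2).
have := P o0 o1; have := P o0 o2; have := P o0 o3; rewrite P0 P1 P2 P3 /perimeter.
have := euclid_distC (v o3) (v o0); have := euclid_distC (v o3) (v o1).
have := euclid_distC (v o3) (v o2); have := euclid_distC (v o2) (v o0).
by move=> *; split; lra.
Qed.

Definition center := 4^-1 *: (v o0 + v o1 + v o2 + v o3).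
(** The axes are halves of the vectors joining the midpoints of opposite edges. *)
Definition axisA := 4^-1 *: (v o0 + v o1 - v o2 - v o3).
Definition axisB := 4^-1 *: (v o0 - v o1 + v o2 - v o3).
Definition axisC := 4^-1 *: (v o0 - v o1 - v o2 + v o3).
Definition box (a b c : R) := center + a *: axisA + b *: axisB + c *: axisC.

Lemma sum4 (V : zmodType) (F : 'I_4 -> V) : \sum_i F i = F o0 + F o1 + F o2 + F o3.
Proof.
rewrite !big_ord_recl big_ord0 addr0 !addrA.
by congr (F _ + F _ + F _ + F _); exact: val_inj.
Qed.

(** These are barycentric coordinates, so [face_form i a b c = -1] describes the plane of the face
    [i]. *)
Lemma boxE a b c : box a b c = \sum_i ((1 + face_form i a b c) / 4) *: v i.
Proof.
rewrite sum4 /face_form /signA /signB /signC /=.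
by apply/rowP => k; rewrite !mxE; lra.
Qed.

Lemma faceP i x : face v i x <-> exists a b c,
  [/\ [/\ -1 <= a <= 1, -1 <= b <= 1 & -1 <= c <= 1],
      face_form i a b c = -1 & x = box a b c].
Proof.
split=> [[w [w0 w1 ->]]|[a [b [c [[a1 b1 c1] abc ->]]]]].
  pose w' j := if j != i then w j else 0.
  have w'0 j : 0 <= w' j by rewrite /w'; case: ifP.
  have w'i : w' i = 0 by rewrite /w' eqxx.
  have w'1 : w' o0 + w' o1 + w' o2 + w' o3 = 1 by rewrite -sum4 -big_mkcond.
  (* The signs, with a column of ones, form a 4 by 4 Hadamard matrix, so signed sums of the weights
     invert [boxE]. *)
  pose a := w' o0 + w' o1 - w' o2 - w' o3.
  pose b := w' o0 - w' o1 + w' o2 - w' o3.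
  pose c := w' o0 - w' o1 - w' o2 + w' o3.
  have w'E j : w' j = (1 + face_form j a b c) / 4.
    rewrite /face_form /signA /signB /signC /a /b /c.
    case: j => [[|[|[|[|//]]]] j4] /=; set l := Ordinal j4.
    - by rewrite (_ : l = o0); [lra | exact: val_inj].
    - by rewrite (_ : l = o1); [lra | exact: val_inj].
    - by rewrite (_ : l = o2); [lra | exact: val_inj].
    - by rewrite (_ : l = o3); [lra | exact: val_inj].
  exists a, b, c; split.
  - have := w'0 o0; have := w'0 o1; have := w'0 o2; have := w'0 o3.
    by rewrite /a /b /c => *; split; apply/andP; split; lra.
  - by have := w'E i; rewrite w'i; lra.
  - rewrite boxE big_mkcond; apply: eq_bigr => j _; rewrite -w'E /w'.
    by case: ifP => // _; rewrite scale0r.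
pose w j := (1 + face_form j a b c) / 4.
have wi : w i = 0 by rewrite /w abc; lra.
exists w; split=> [j||].
(* For [j] other than [i] the sign vectors agree in one entry only, so the two forms add up to twice
   a coordinate up to sign, which is at least -2. *)
- suff : 0 <= 1 + face_form j a b c by rewrite /w; lra.
  have : -1 <= face_form j a b c; last by lra.
  rewrite -abc /face_form /signA /signB /signC; move: abc.
  rewrite /face_form /signA /signB /signC.
  by case: i {wi} => [[|[|[|[|//]]]] ?]; case: j => [[|[|[|[|//]]]] ?] /=; lra.
- have : \sum_j w j = 1.
    by rewrite sum4 /w /face_form /signA /signB /signC /=; lra.
  by rewrite (bigD1 i)//= wi add0r.
- by rewrite boxE (bigD1 i)//= -/(w i) wi scale0r add0r.
Qed.

Section Axes.
Hypothesis tetra : is_tetrahedron v.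
Hypothesis iso : isosceles v.

(** Up to the factor 16, each inner product is the difference of the squared lengths of two opposite
    edges. *)
Lemma axes_orthogonal :
  [/\ dot axisA axisB = 0, dot axisA axisC = 0 & dot axisB axisC = 0].
Proof.
have [e1 e2 e3] := isosceles_opposite_edges iso.
move: (congr1 (fun x => x ^+ 2) e1) (congr1 (fun x => x ^+ 2) e2) (congr1 (fun x => x ^+ 2) e3).
rewrite !euclid_dist_sqr /axisA /axisB /axisC !dotE.
have := dotC (v o3) (v o0); have := dotC (v o3) (v o1); have := dotC (v o3) (v o2).
have := dotC (v o2) (v o0); have := dotC (v o2) (v o1); have := dotC (v o1) (v o0).
move=> C10 C20 C21 C32 C31 C30.
by move=> E1 E2 E3; split; lra.
Qed.

(** Four times an axis is a combination of the edge vectors at [v o0] with coefficients 1 and -1. *)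
Lemma axes_neq0 : [/\ axisA != 0, axisB != 0 & axisC != 0].
Proof.
have free (a b c : R) : a *: (v o1 - v o0) + b *: (v o2 - v o0) + c *: (v o3 - v o0) = 0 ->
    [/\ a = 0, b = 0 & c = 0].
  move=> abc.
  pose u : 'rV[R]_3 := \row_k [:: a; b; c]`_k.
  have /row_free_inj := tetra; move=> /(_ _ u 0); rewrite mul0mx.
  have -> : u *m \matrix_(i < 3) (v (lift ord0 i) - v ord0) = 0.
    rewrite mulmx_sum_row !big_ord_recl big_ord0 addr0 !rowK !mxE /= -[RHS]abc addrA.
    by congr (_ *: (v _ - v _) + _ *: (v _ - v _) + _ *: (v _ - v _)); exact: val_inj.
  move=> /(_ erefl) /rowP u0.
  by have := u0 0; have := u0 1; have := u0 (lift ord0 1); rewrite !mxE.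
have unscale (w : 'rV[R]_3) : 4^-1 *: w = 0 -> w = 0.
  by move/eqP; rewrite scaler_eq0 invr_eq0 pnatr_eq0 => /eqP.
have indep (w : 'rV[R]_3) (a b c : R) : a != 0 ->
    a *: (v o1 - v o0) + b *: (v o2 - v o0) + c *: (v o3 - v o0) = w -> 4^-1 *: w != 0.
  by move=> a0 abc; apply: contra a0 => /eqP/unscale w0; have [->] := free a b c (etrans abc w0).
split.
- by apply: (indep _ 1 (-1) (-1)); rewrite ?oner_neq0//; apply/rowP => k; rewrite !mxE; lra.
- apply: (indep _ (-1) 1 (-1)); rewrite ?oppr_eq0 ?oner_neq0//.
  by apply/rowP => k; rewrite !mxE; lra.
- apply: (indep _ (-1) (-1) 1); rewrite ?oppr_eq0 ?oner_neq0//.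
  by apply/rowP => k; rewrite !mxE; lra.
Qed.

Lemma box_dist a b c a' b' c' : euclid_dist (box a b c) (box a' b' c') ^+ 2 =
  dot axisA axisA * (a - a') ^+ 2 + dot axisB axisB * (b - b') ^+ 2
  + dot axisC axisC * (c - c') ^+ 2.
Proof.
rewrite euclid_dist_sqr.
have -> : box a b c - box a' b' c' =
    (a - a') *: axisA + (b - b') *: axisB + (c - c') *: axisC.
  by apply/rowP => k; rewrite !mxE; lra.
have := axes_orthogonal; move: axisA axisB axisC => A B C [AB AC BC].
by rewrite !dotE (dotC B A) (dotC C A) (dotC C B) AB AC BC !expr2; lra.
Qed.

End Axes.
End Tetrahedron.

(** * Oblique coordinates on the Euclidean plane *)

Section PlanarCoordinates.
Context {R : realType}.

(* A Cholesky decomposition makes any frame of the plane with the prescribed Gram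
   matrix explicit. *)
Lemma planar_coordinates (p q r : R) : 0 < p -> 0 < q -> 0 < r ->
  exists s t : 'rV[R]_2 -> R,
  [/\ forall x y, 4 * (p * (t x - t y) ^+ 2 + q * (s x - s y) ^+ 2
                       + r * (s x + t x - (s y + t y)) ^+ 2) = euclid_dist x y ^+ 2,
      forall a b, exists x, s x = a /\ t x = b
    & forall k x y, s (x + k *: y) = s x + k * s y /\ t (x + k *: y) = t x + k * t y].
Proof.
move=> p0 q0 r0.
pose P : R := Num.sqrt (4 * (q + r)).
have P2 : P ^+ 2 = 4 * (q + r) by rewrite sqr_sqrtr//; lra.
have P0 : 0 < P by rewrite sqrtr_gt0; lra.
pose k := 4 * r / P.
have kP : k * P = 4 * r by rewrite /k mulfVK// gt_eqF.
(* Multiplied by [P ^+ 2] this is the Gram determinant [16 * (p * q + p * r + q * r)]. *)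
have D2_gt0 : 0 < 4 * (p + r) - k ^+ 2.
  rewrite -(pmulr_rgt0 _ (exprn_gt0 2 P0)) mulrBr -exprMn (mulrC P) kP P2.
  by have := mulr_gt0 p0 q0; have := mulr_gt0 p0 r0; have := mulr_gt0 q0 r0; rewrite !expr2; lra.
pose D : R := Num.sqrt (4 * (p + r) - k ^+ 2).
have D2 : D ^+ 2 = 4 * (p + r) - k ^+ 2 by rewrite sqr_sqrtr// ltW.
have D0 : 0 < D by rewrite sqrtr_gt0.
have Du : D != 0 by rewrite gt_eqF.
have Pu : P != 0 by rewrite gt_eqF.
pose t (x : 'rV[R]_2) := x 0 1 / D.
pose s (x : 'rV[R]_2) := (x 0 0 - k * t x) / P.
have tE (x : 'rV[R]_2) : x 0 1 = D * t x by rewrite /t mulrCA divff ?mulr1.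
have sE (x : 'rV[R]_2) : x 0 0 = P * s x + k * t x by rewrite /s mulrCA divff ?mulr1 ?subrK.
exists s, t; split=> [x y|a b|l x y].
- rewrite euclid_dist_sqr /dot big_ord_recl big_ord1 !mxE.
  rewrite (_ : lift ord0 ord0 = 1 :> 'I_2); last exact: val_inj.
  rewrite !tE !sE; set u := s x; set u' := s y; set w := t x; set w' := t y.
  transitivity (P ^+ 2 * (u - u') ^+ 2 + 2 * (k * P) * (u - u') * (w - w')
                + (D ^+ 2 + k ^+ 2) * (w - w') ^+ 2); last by rewrite !expr2; lra.
  by rewrite P2 D2 kP !expr2; lra.
- pose x : 'rV[R]_2 := \row_i (if i == 0 then P * a + k * b else D * b).
  have tx : t x = b by rewrite /t mxE /= mulrC mulKf.
  by exists x; rewrite tx /s tx mxE /= addrK mulrC mulKf.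
- have tl : t (x + l *: y) = t x + l * t y by rewrite /t !mxE mulrDl mulrA.
  by split=> //; rewrite /s tl !mxE; lra.
Qed.

Lemma euclid_dist_affine n (x0 x y : 'rV[R]_n) k : 0 <= k ->
  euclid_dist (x0 + k *: x) (x0 + k *: y) = k * euclid_dist x y.
Proof.
move=> k0; rewrite !euclid_distE opprD addrACA subrr add0r -scalerBr dotZl dotZr mulrA.
by rewrite -expr2 sqrtrM ?sqr_ge0// sqrtr_sqr ger0_norm.
Qed.

End PlanarCoordinates.

(** * The plane folded onto the surface, and local lifts *)

Section Unfolding.
Context {R : realType} (v : 'I_4 -> 'rV[R]_3).
Hypotheses (tetra : is_tetrahedron v) (iso : isosceles v).
Let A2 := dot (axisA v) (axisA v).
Let B2 := dot (axisB v) (axisB v).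
Let C2 := dot (axisC v) (axisC v).
Let T := tetrahedron_surface v.

Let axes_gt0 : [/\ 0 < A2, 0 < B2 & 0 < C2].
Proof. by have [? ? ?] := axes_neq0 tetra; rewrite /A2 /B2 /C2 !dot_gt0; split. Qed.

(* The folding of the plane onto the surface, in the oblique coordinates for which
   the points over the vertices form the lattice Z^2. *)
Definition fold (s t : R) := box v (wave t) (wave s) (wave (s + t)).

Lemma box_inj a b c a' b' c' : box v a b c = box v a' b' c' -> [/\ a = a', b = b' & c = c'].
Proof.
move=> e; have := box_dist iso a b c a' b' c'; rewrite e euclid_distxx expr0n/=.
have [A0 B0 C0] := axes_gt0; rewrite -/A2 -/B2 -/C2.
have sq (k x : R) : 0 < k -> 0 <= k * x ^+ 2 by move=> k0; rewrite mulr_ge0 ?sqr_ge0// ltW.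
have sq0 (k x y : R) : 0 < k -> k * (x - y) ^+ 2 = 0 -> x = y.
  by move=> k0 /eqP; rewrite mulf_eq0 gt_eqF//= sqrf_eq0 subr_eq0 => /eqP.
have := sq A2 (a - a') A0; have := sq B2 (b - b') B0; have := sq C2 (c - c') C0.
by move=> *; split; [apply: (sq0 A2) | apply: (sq0 B2) | apply: (sq0 C2)] => //; lra.
Qed.

Lemma fold_surface s t : T (fold s t).
Proof.
have [i fi _] := tile_exists s t; exists i => //; apply/faceP.
by exists (wave t), (wave s), (wave (s + t)); rewrite !wave_le1.
Qed.

Lemma fold_dist_le s t s' t' : euclid_dist (fold s t) (fold s' t') ^+ 2 <=
  4 * (A2 * (t - t') ^+ 2 + B2 * (s - s') ^+ 2 + C2 * (s + t - (s' + t')) ^+ 2).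
Proof.
have [A0 B0 C0] := axes_gt0; rewrite box_dist//.
have le_sq (x y : R) : (wave x - wave y) ^+ 2 <= 4 * (x - y) ^+ 2.
  have -> : 4 * (x - y) ^+ 2 = (2 * `|x - y|) ^+ 2.
    by rewrite exprMn real_normK ?num_real// expr2; lra.
  by rewrite -real_normK ?num_real// ler_sqr ?nnegrE ?mulr_ge0// wave_lipschitz.
rewrite -/A2 -/B2 -/C2 !mulrDr (mulrCA 4 A2) (mulrCA 4 B2) (mulrCA 4 C2).
by apply: lerD; [apply: lerD|]; rewrite ler_pM2l//; exact: le_sq.
Qed.

(** Along the branches used by [fold_lift] the planar quadratic form reproduces the chord
    exactly. *)
Lemma fold_face_lift i s t q : face v i (fold s t) -> face v i q ->
  exists s' t', fold s' t' = q /\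
    4 * (A2 * (t - t') ^+ 2 + B2 * (s - s') ^+ 2 + C2 * (s + t - (s' + t')) ^+ 2)
    = euclid_dist (fold s t) q ^+ 2.
Proof.
move=> /faceP[a0 [b0 [c0 [_ abc0 /box_inj[ea eb ec]]]]].
move=> /faceP[a [b [c [[a1 b1 c1] abc ->]]]].
rewrite -ea -eb -ec in abc0.
have [s' [t' [<- <- <- [et es est]]]] := fold_lift a1 b1 c1 abc abc0.
exists s', t'; split=> //; rewrite box_dist// -/A2 -/B2 -/C2.
rewrite !mulrDr (mulrCA 4 A2) (mulrCA 4 B2) (mulrCA 4 C2) et es est.
by congr (_ * _ + _ * _ + _ * _); rewrite -sqrrN opprB.
Qed.

(** A point of the surface has positive distance from the plane of every face that does not contain
    it. *)
Lemma faces_near p : T p -> exists2 e, 0 < e &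
  forall p', T p' -> euclid_dist p' p < e -> exists i, face v i p /\ face v i p'.
Proof.
move=> [i0 _ /faceP[a [b [c [abc1 _ pE]]]]].
have [A0 B0 C0] := axes_gt0.
(* [h i] is 4 times the barycentric coordinate of [p] at [v i]; it vanishes exactly when [p] is on
   the face [i]. *)
pose h i := 1 + face_form i a b c.
pose m := \big[Num.min/1]_(i | h i != 0) `|h i|.
have m0 : 0 < m by rewrite lt_bigmin// => i; rewrite normr_gt0.
pose mu := Num.min A2 (Num.min B2 C2).
have mu0 : 0 < mu by rewrite !lt_min A0 B0 C0.
have muA : mu <= A2 by rewrite ge_min lexx.
have muB : mu <= B2 by rewrite !ge_min lexx orbT.
have muC : mu <= C2 by rewrite !ge_min lexx !orbT.
(* The 3 is the Cauchy-Schwarz constant for a signed sum of three coordinate differences. *)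
exists (Num.sqrt (mu / 3) * m); first by rewrite mulr_gt0// sqrtr_gt0 divr_gt0.
move=> p' [i _ fi] dist_lt; exists i; split=> //.
have /faceP[a' [b' [c' [_ abc' pE']]]] := fi.
have [h0|h0] := eqVneq (h i) 0.
  by apply/faceP; exists a, b, c; split=> //; move: h0; rewrite /h; lra.
have le_m : m <= `|h i| by apply: bigmin_le_cond.
have : euclid_dist p' p ^+ 2 < mu / 3 * m ^+ 2.
  rewrite -[mu / 3]sqr_sqrtr ?divr_ge0 ?(ltW mu0)// -exprMn.
  by rewrite ltr_sqr ?nnegrE ?euclid_dist_ge0 ?mulr_ge0 ?sqrtr_ge0 ?(ltW m0).
suff : mu / 3 * m ^+ 2 <= euclid_dist p' p ^+ 2 by case: ltgtP.
rewrite pE pE' box_dist// -/A2 -/B2 -/C2.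
pose x := a' - a; pose y := b' - b; pose z := c' - c.
apply: (@le_trans _ _ (mu * (x ^+ 2 + y ^+ 2 + z ^+ 2))); last first.
  by rewrite !mulrDr !lerD// ler_wpM2r ?sqr_ge0.
rewrite -mulrA ler_pM2l// mulrC ler_pdivrMr//.
apply: (@le_trans _ _ (`|h i| ^+ 2)).
  by rewrite ler_sqr ?nnegrE ?normr_ge0 ?(ltW m0).
rewrite real_normK ?num_real// (_ : h i = - (signA i * x + signB i * y + signC i * z)).
  have := sqr_ge0 (x - y); have := sqr_ge0 (y - z); have := sqr_ge0 (x - z).
  have := sqr_ge0 (x + y); have := sqr_ge0 (y + z); have := sqr_ge0 (x + z).
  by case: i {fi abc' h0 le_m} => [[|[|[|[|//]]]] ?]; rewrite /signA /signB /signC !expr2 /=; lra.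
by move: abc'; rewrite /h /face_form /x /y /z; lra.
Qed.

Lemma fold_surjective q : T q -> exists s t, fold s t = q.
Proof.
move=> [i _ fq].
have w0 : wave 0 = 1 :> R.
  by have [||-> _] := @wave_falling R 0 0 0; rewrite ?mulr0z; lra.
have w1 : wave 1 = -1 :> R.
  by have [||-> _] := @wave_falling R 0 1 1; rewrite ?mulr0z; lra.
suff [s [t f_st]] : exists s t : R, face_form i (wave t) (wave s) (wave (s + t)) = -1.
  have f0 : face v i (fold s t).
    by apply/faceP; exists (wave t), (wave s), (wave (s + t)); rewrite !wave_le1.
  by have [s' [t' [<- _]]] := fold_face_lift f0 fq; exists s', t'.
(* The origin lies over vertex 0, which is on every face but the face 0; [s = 0], [t = 1] lies over
   vertex 2, which is on the face 0. *)
have [i0|i0] := eqVneq (i : nat) 0%N.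
  by exists 0, 1; rewrite add0r w0 w1 /face_form /signA /signB /signC i0 /=; lra.
exists 0, 0; rewrite addr0 w0 /face_form /signA /signB /signC.
by case: i i0 {fq} => [[|[|[|[|//]]]] ?] //= _; lra.
Qed.

End Unfolding.

(** * The folding map meets the conditions of the comparison *)

Theorem corollary4p4 (R : realType) (v : 'I_4 -> 'rV[R]_3)
    (v_tetrahedron : is_tetrahedron v) (v_isosceles : isosceles v) :
  steiner_ratio (tetrahedron_surface v) (intrinsic_dist (tetrahedron_surface v))
  = steiner_ratio [set: 'rV[R]_2] euclid_dist.
Proof.
set T := tetrahedron_surface v.
have [nA nB nC] := axes_neq0 v_tetrahedron.
rewrite -dot_gt0 in nA; rewrite -dot_gt0 in nB; rewrite -dot_gt0 in nC.
have [s [t [quad onto affine]]] := planar_coordinates nA nB nC.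
pose f (x : 'rV[R]_2) := fold v (s x) (t x).
have fT x : T (f x) by exact: fold_surface.
have surj q : T q -> exists x, f x = q.
  move=> /(fold_surjective v_tetrahedron v_isosceles)[a [b <-]].
  by have [x [sx tx]] := onto a b; exists x; rewrite /f sx tx.
have chord x y : euclid_dist (f x) (f y) <= euclid_dist x y.
  rewrite -(@ler_pXn2r _ 2)// ?nnegrE ?euclid_dist_ge0// -quad.
  exact: fold_dist_le.
(* Folded segments are curves not longer than the segments; they also make every intrinsic distance
   on [T] finite. *)
pose seg (x y : 'rV[R]_2) (u : R) := f (x + u *: (y - x)).
have seg_lip x y a b : 0 <= a <= 1 -> 0 <= b <= 1 ->
    euclid_dist (seg x y a) (seg x y b) <= euclid_dist x y * `|a - b|.
  move=> _ _; apply: le_trans (chord _ _) _.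
  rewrite !euclid_distE opprD addrACA subrr add0r -scalerBl dotZl dotZr mulrA -expr2.
  rewrite sqrtrM ?sqr_ge0// sqrtr_sqr mulrC -!euclid_distE.
  by rewrite euclid_distC.
have seg_curve x y : curve_in T (f x) (f y) (seg x y).
  split=> [|||u _]; [exact: lipschitz_within_continuous (seg_lip x y)| | |exact: fT].
  - by rewrite /seg scale0r addr0.
  - by rewrite /seg scale1r addrC subrK.
have seg_length x y : (curve_length (seg x y) <= (euclid_dist x y)%:E)%E.
  exact: curve_length_lipschitz (seg_lip x y).
have f_le x y : intrinsic_dist T (f x) (f y) <= euclid_dist x y.
  exact: intrinsic_dist_le (seg_curve x y) (seg_length x y).
have chord_le p q : T p -> T q -> euclid_dist p q <= intrinsic_dist T p q.
  move=> /surj[x <-] /surj[y <-].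
  exact: euclid_dist_le_intrinsic (seg_curve x y) (seg_length x y).
pose w1 : 'rV[R]_2 := 0; pose w2 : 'rV[R]_2 := const_mx 1.
have w12 : w1 != w2.
  by apply/eqP => /rowP/(_ 0); rewrite !mxE => /eqP; rewrite eq_sym oner_eq0.
apply: (steiner_ratio_folding (delta := euclid_dist) (d := euclid_dist) (f := f)
          _ _ _ _ _ _ _ _ _ _ w12).
- exact: intrinsic_dist_ge0.
- exact: euclid_distxx.
- exact: euclid_distC.
- exact: euclid_dist_triangle.
- exact: euclid_dist_gt0.
- exact: chord_le.
- exact: euclid_distxx.
- exact: euclid_distC.
- exact: euclid_dist_triangle.
- exact: euclid_dist_gt0.
- exact: fT.
- exact: surj.
- exact: f_le.
- move=> x q e /surj[y' <-] e0.
  (* A curve exceeding the intrinsic distance by less than [e] is lifted from [x]. *)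
  have := intrinsic_distE (seg_curve x y') (seg_length x y') => rhoE.
  have : (ereal_inf [set curve_length g | g in curve_in T (f x) (f y')]
          < (intrinsic_dist T (f x) (f y') + e)%:E)%E.
    by rewrite -rhoE lte_fin ltrDl.
  move=> /ereal_inf_lt[_ [g cg <-] lt_g].
  have loc i p p' : face v i p -> face v i p' -> forall y, f y = p ->
      exists2 z, f z = p' & euclid_dist y z <= euclid_dist p p'.
    move=> fp fp' y fy; rewrite -fy in fp.
    have [a [b [ab ab_dist]]] := fold_face_lift v_tetrahedron v_isosceles fp fp'.
    have [z [sz tz]] := onto a b; exists z; first by rewrite /f sz tz.
    rewrite -(@ler_pXn2r _ 2)// ?nnegrE ?euclid_dist_ge0// -quad sz tz ab_dist.
    by rewrite -fy.
  have [|||y [fy le_d]] := @curve_lift R 3 _ euclid_dist f T x (f y') g _ _ _ cg.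
  + exact: euclid_distxx.
  + by move=> y z; exact: euclid_dist_triangle.
  + move=> p Tp; have [e' e'0 near] := faces_near v_tetrahedron v_isosceles Tp.
    exists e' => // p' Tp' pp'; have [i [fp fp']] := near _ Tp' pp'.
    by split; apply: (loc i).
  exists y => //.
  by rewrite -lee_fin (le_trans le_d)// ltW.
move=> M.
(* An interior point of the triangle [s >= 0], [t >= 0], [s + t <= 1]; the scale [k] lets the
   coordinates of the copy of [M] deviate from it by at most 1/8. *)
have [x0 [s0 t0]] := onto (1 / 4) (1 / 4).
pose sum := \sum_(y <- M) (`|s y| + `|t y|).
have sum0 : 0 <= sum by rewrite sumr_ge0// => y _; rewrite addr_ge0.
pose k := (8 * (1 + sum))^-1.
have k0 : 0 < k by rewrite invr_gt0; lra.
pose h (y : 'rV[R]_2) : 'rV[R]_2 := x0 + k *: y.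
have hd (x y : 'rV[R]_2) : euclid_dist (h x) (h y) = k * euclid_dist x y.
  by rewrite euclid_dist_affine// ltW.
exists k, h; split=> // x y xM yM.
(* The intrinsic distance lies between the chord and the planar distance, which coincide on this
   triangle because the waves are linear there. *)
apply/eqP; rewrite eq_le -hd f_le/=; apply: le_trans (chord_le _ _ (fT _) (fT _)).
have small z : z \in M -> [/\ 0 <= s (h z), 0 <= t (h z) & s (h z) + t (h z) <= 1].
  move=> zM; have [-> ->] := affine k x0 z; rewrite s0 t0.
  have le_sum : `|s z| + `|t z| <= sum.
    by rewrite /sum (bigD1_seq z)//= ?fset_uniq// lerDl sumr_ge0// => y' _; rewrite addr_ge0.
  have : k * (`|s z| + `|t z|) <= 1 / 8.
    apply: (@le_trans _ _ (k * (1 + sum))); first by rewrite ler_pM2l//; lra.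
    by rewrite /k invfM -mulrA mulVf ?mulr1 ?mul1r// gt_eqF//; lra.
  have := ler_norm (k * s z); have := ler_norm (- (k * s z)).
  have := ler_norm (k * t z); have := ler_norm (- (k * t z)).
  rewrite !normrN !normrM (gtr0_norm k0) mulrDr.
  by move=> *; split; lra.
have wave_lin (a : R) : 0 <= a <= 1 -> wave a = 1 - 2 * a.
  by move=> a01; have [||->] := @wave_falling R 0 a a; rewrite ?mulr0z; lra.
rewrite -(@ler_pXn2r _ 2)// ?nnegrE ?euclid_dist_ge0// box_dist// -quad.
have [sx0 tx0 stx] := small x xM; have [sy0 ty0 sty] := small y yM.
by rewrite !wave_lin ?expr2; lra.
Qed.
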